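(* Let $s=(s_0,s_1,s_2)$ with $2=s_0\le s_1\le s_2$. Then, as $n\to\infty$, $|P_n(s)|^{\frac1{n^2}}$ converges to a limit in the interval $[1,2e]$.
   Context: For an integer $n\ge1$ let $V(\mathbb{T}_n)=(\mathbb{Z}/n\mathbb{Z})^2$ be the vertex set of the discrete torus obtained from the triangular lattice $\mathbb{Z}+\mathbb{Z}\omega$, $\omega=e^{2\pi i/3}$, modulo $n$ (with $1\mapsto(1,0)$, $\omega\mapsto(0,1)$). For $f:V(\mathbb{T}_n)\to\mathbb{R}$ the discrete Hessian on the three families $E_0,E_1,E_2$ of unit rhombi is given by $D_0f(a,b)=f(a,b)+f(a+2,b+1)-f(a+1,b)-f(a+1,b+1)$, $D_1f(a,b)=f(a+1,b)+f(a,b+1)-f(a,b)-f(a+1,b+1)$, $D_2f(a,b)=f(a,b)+f(a+1,b+2)-f(a+1,b+1)-f(a,b+1)$. For $s=(s_0,s_1,s_2)\in\mathbb{R}_{>0}^3$, $P_n(s)$ is the bounded convex polytope of all $g:V(\mathbb{T}_n)\to\mathbb{R}$ with $\sum_v g(v)=0$ and $D_rg(v)\le s_r$ for all $v$ and $r\in\{0,1,2\}$; $|P_n(s)|$ is its $(n^2-1)$-dimensional Lebesgue measure in the hyperplane of mean-zero functions. *)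

(* Defs.v *)
From HB Require Import structures.
From mathcomp Require Import all_boot all_order all_algebra.
From mathcomp Require Import all_classical all_reals all_analysis.

Set Implicit Arguments.
Unset Strict Implicit.
Unset Printing Implicit Defensive.

Import Order.TTheory GRing.Theory Num.Theory.
Import numFieldNormedType.Exports.

Local Open Scope classical_set_scope.
Local Open Scope ring_scope.

Section LebesgueTuple.
Context {R : realType}.

Definition cons_pair m (p : measurableTypeR R * m.-tuple (measurableTypeR R)) :
  m.+1.-tuple (measurableTypeR R) := [tuple of p.1 :: p.2].

Definition uncons_pair m (t : m.+1.-tuple (measurableTypeR R)) :
    measurableTypeR R * m.-tuple (measurableTypeR R) :=
  (thead t, [tuple of behead t]).

(* Lebesgue measure on R^m, as the m-fold product of the Lebesgue measure on R;
   on R^0 it is the unit mass at the only point. *)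
Fixpoint lebesgue_tuple m : set (m.-tuple (measurableTypeR R)) -> \bar R :=
  match m with
  | 0 => fun A => \d_([tuple] : 0.-tuple (measurableTypeR R)) A
  | m'.+1 => pushforward (lebesgue_measure \x @lebesgue_tuple m')%E
                         (@cons_pair m')
  end.

Lemma measurable_cons_pair m : measurable_fun setT (@cons_pair m).
Proof. exact: measurable_cons. Qed.

Lemma measurable_uncons_pair m : measurable_fun setT (@uncons_pair m).
Proof.
apply/measurable_fun_pair; first exact: measurable_tnth.
exact: measurable_behead.
Qed.

Lemma uncons_pairK m : cancel (@uncons_pair m) (@cons_pair m).
Proof. by move=> t; rewrite [RHS]tuple_eta; apply: val_inj. Qed.

Lemma cons_pairK m : cancel (@cons_pair m) (@uncons_pair m).
Proof. by move=> [x t]; congr pair; apply: val_inj. Qed.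

Definition cons_measure m
    (mu : {sigma_finite_measure set (m.-tuple (measurableTypeR R)) -> \bar R}) :
    set (m.+1.-tuple (measurableTypeR R)) -> \bar R :=
  pushforward (lebesgue_measure \x mu)%E (@cons_pair m).

HB.instance Definition _ m mu := Measure.copy (@cons_measure m mu)
  (measure_function_pushforward__canonical__measure_function_Measure
    ((lebesgue_measure \x mu)%E : {measure set _ -> \bar R})
    (@measurable_cons_pair m)).

Let cons_measure_sigma_finite m
    (mu : {sigma_finite_measure set (m.-tuple (measurableTypeR R)) -> \bar R}) :
  sigma_finite setT (cons_measure mu).
Proof.
have /sigma_finiteP[F [TF ndF Foo]] := sigma_finiteT (@lebesgue_measure R).
have /sigma_finiteP[G [TG ndG Goo]] := sigma_finiteT mu.
exists (fun i => @uncons_pair m @^-1` (F i `*` G i)).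
  apply/esym; rewrite -subTset => t _.
  have [i _ Fi] : (\bigcup_i F i) (thead t) by rewrite -TF.
  have [j _ Gj] : (\bigcup_i G i) [tuple of behead t] by rewrite -TG.
  exists (maxn i j) => //; split => /=.
    by move: Fi; exact/subsetPset/ndF/leq_maxl.
  by move: Gj; exact/subsetPset/ndG/leq_maxr.
move=> i; have [mF Fioo] := Foo i; have [mG Gioo] := Goo i; split.
  rewrite -[X in measurable X]setTI; apply: measurable_uncons_pair => //.
  exact: measurableX.
rewrite /cons_measure /pushforward (_ : _ @^-1` _ = F i `*` G i); last first.
  by apply/funext => p; rewrite /preimage /mkset cons_pairK.
by rewrite product_measure1E// lte_mul_pinfty// ge0_fin_numE.
Qed.

HB.instance Definition _ m mu := Measure_isSigmaFinite.Build _ _ _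
  (@cons_measure m mu) (cons_measure_sigma_finite mu).

Let lebesgue_tuple_sigma_finite_measure m :
  exists mu : {sigma_finite_measure set (m.-tuple (measurableTypeR R)) -> \bar R},
    @lebesgue_tuple m = mu.
Proof.
elim: m => [|m [mu IH]].
  by exists (\d_([tuple] : 0.-tuple (measurableTypeR R))).
by exists (cons_measure mu); rewrite /= IH.
Qed.

Let lebesgue_tuple0 m : @lebesgue_tuple m set0 = 0%E.
Proof. by have [mu ->] := lebesgue_tuple_sigma_finite_measure m. Qed.

Let lebesgue_tuple_ge0 m A : (0 <= @lebesgue_tuple m A)%E.
Proof. by have [mu ->] := lebesgue_tuple_sigma_finite_measure m. Qed.

Let lebesgue_tuple_sigma_additive m : semi_sigma_additive (@lebesgue_tuple m).
Proof.
have [mu ->] := lebesgue_tuple_sigma_finite_measure m.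
exact: measure_semi_sigma_additive.
Qed.

HB.instance Definition _ m := isMeasure.Build _ _ _ (@lebesgue_tuple m)
  (@lebesgue_tuple0 m) (@lebesgue_tuple_ge0 m) (@lebesgue_tuple_sigma_additive m).

Let lebesgue_tuple_sigma_finite m : sigma_finite setT (@lebesgue_tuple m).
Proof.
have [mu ->] := lebesgue_tuple_sigma_finite_measure m.
exact: sigma_finiteT.
Qed.

HB.instance Definition _ m := Measure_isSigmaFinite.Build _ _ _
  (@lebesgue_tuple m) (@lebesgue_tuple_sigma_finite m).

End LebesgueTuple.

Section MeanZeroVolume.
Context {R : realType} (T : finType).

(* The Helmert basis: with the points of T listed as x_0, x_1, ..., its k-th
   vector is (x_0 + ... + x_k - (k + 1) x_(k+1)) / sqrt ((k + 1) (k + 2)).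
   By the two lemmas below, the vectors with k < #|T| - 1 are mean-zero and
   orthonormal, hence an orthonormal basis of the (#|T| - 1)-dimensional
   hyperplane of mean-zero functions on T. *)
Definition helmert (k : nat) (x : T) : R :=
  ((enum_rank x <= k)%N%:R - k.+1%:R * (enum_rank x == k.+1 :> nat)%:R)
    / Num.sqrt (k.+1 * k.+2)%:R.

Let hcoef (k j : nat) : R := (j <= k)%N%:R - k.+1%:R * (j == k.+1)%:R.

Let hcoef_sum k n (F : nat -> R) : (k.+1 < n)%N ->
  \sum_(j < n) hcoef k j * F j = \sum_(j < k.+1) F j - k.+1%:R * F k.+1.
Proof.
move=> kn; rewrite -(big_mkord xpredT (fun j => hcoef k j * F j)).
rewrite (@big_cat_nat _ _ _ k.+2)//= [X in _ + X]big_nat_cond [X in _ + X]big1.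
  rewrite addr0 big_mkord big_ord_recr/= /hcoef eqxx ltnn mulr1 sub0r mulNr.
  congr (_ - _); apply: eq_bigr => j _.
  by rewrite -ltnS ltn_ord (ltn_eqF (ltn_ord j)) mulr0 subr0 mul1r.
move=> j /andP[/andP[kj _] _].
by rewrite /hcoef leqNgt (ltnW kj)/= gtn_eqF// mulr0 subrr mul0r.
Qed.

Let sum_rank (F : nat -> R) : \sum_(x : T) F (enum_rank x) = \sum_(j < #|T|) F j.
Proof.
rewrite (reindex_onto (@enum_val T T) (@enum_rank T))/=; last first.
  by move=> x _; rewrite enum_rankK.
rewrite [LHS](eq_bigl xpredT); last by move=> i; rewrite enum_valK eqxx.
by apply: eq_bigr => i _; rewrite enum_valK.
Qed.

Let helmert_lt (k : 'I_(#|T|.-1)) : (k.+1 < #|T|)%N.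
Proof. by rewrite -ltn_predRL. Qed.

Lemma helmert_mean_zero (k : 'I_(#|T|.-1)) : \sum_x helmert k x = 0.
Proof.
rewrite -mulr_suml (sum_rank (hcoef k)).
under eq_bigr do rewrite -[hcoef _ _]mulr1.
rewrite (hcoef_sum (fun=> 1) (helmert_lt k)).
by rewrite sumr_const card_ord mulr1 subrr mul0r.
Qed.

Lemma helmert_orthonormal (k l : 'I_(#|T|.-1)) :
  \sum_x helmert k x * helmert l x = (k == l)%:R.
Proof.
pose c (i : nat) : R := Num.sqrt (i.+1 * i.+2)%:R.
suff H : forall i j : 'I_(#|T|.-1), (i <= j)%N ->
    \sum_(x : T) hcoef i (enum_rank x) * hcoef j (enum_rank x) =
    (i == j)%:R * (c i * c j).
  wlog kl : k l / (k <= l)%N => [hw|].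
    have [|/ltnW] := leqP k l; first exact: hw.
    move=> /hw; rewrite eq_sym => <-.
    by apply: eq_bigr => x _; rewrite mulrC.
  have c0 i : c i != 0 by rewrite gt_eqF// sqrtr_gt0 ltr0n muln_gt0.
  transitivity ((k == l)%:R * (c k * c l) / (c k * c l)); last first.
    by rewrite mulfK// mulf_neq0.
  rewrite -H// mulr_suml; apply: eq_bigr => x _.
  by rewrite /helmert -/(c k) -/(c l) invfM mulrACA.
move=> i j ij; rewrite (sum_rank (fun n => hcoef i n * hcoef j n)).
rewrite (hcoef_sum (hcoef j) (helmert_lt i)).
have -> : \sum_(n < i.+1) hcoef j n = i.+1%:R.
  rewrite (eq_bigr (fun=> 1)) ?sumr_const ?card_ord// => n _.
  have nj : (n <= j)%N by rewrite (leq_trans _ ij)// -ltnS.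
  by rewrite /hcoef nj ltn_eqF ?ltnS// mulr0 subr0.
have [<-|ne] := eqVneq i j.
  rewrite /hcoef ltnn eqxx /c -expr2 sqr_sqrtr// natrM mul1r.
  rewrite mulr1 mulr0n sub0r mulrN opprK [in RHS]mulrC.
  by rewrite -[in RHS]natr1 mulrDl mul1r addrC.
have lt : (i < j)%N by rewrite ltn_neqAle ij andbT.
by rewrite /hcoef lt eqSS ltn_eqF// mulr0 subr0 mulr1 subrr mul0r.
Qed.

Definition of_helmert_coord (t : (#|T|.-1).-tuple (measurableTypeR R)) : T -> R :=
  fun x => \sum_(k < #|T|.-1) tnth t k * helmert k x.

(* (#|T| - 1)-dimensional Lebesgue measure on the Euclidean hyperplane of
   mean-zero functions, read through the isometry of_helmert_coord. *)
Definition mean_zero_volume (A : set (T -> R)) : \bar R :=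
  lebesgue_tuple (of_helmert_coord @^-1` A).

End MeanZeroVolume.

(* (Z/nZ)^2; ordS is addition of 1 modulo n. *)
Definition torus (n : nat) : finType := ('I_n * 'I_n)%type.

Lemma card_torus n : #|torus n| = (n ^ 2)%N.
Proof. by rewrite card_prod card_ord. Qed.

Section Hessian.
Context {R : realType} (n : nat).
Implicit Types (f : torus n -> R) (v : torus n).

Definition hess0 f v : R := let: (a, b) := v in
  f (a, b) + f (ordS (ordS a), ordS b) - f (ordS a, b) - f (ordS a, ordS b).

Definition hess1 f v : R := let: (a, b) := v in
  f (ordS a, b) + f (a, ordS b) - f (a, b) - f (ordS a, ordS b).

Definition hess2 f v : R := let: (a, b) := v in
  f (a, b) + f (ordS a, ordS (ordS b)) - f (ordS a, ordS b) - f (a, ordS b).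

Definition hessian_polytope (s0 s1 s2 : R) : set (torus n -> R) :=
  [set g | \sum_v g v = 0 /\
           forall v, [/\ hess0 g v <= s0, hess1 g v <= s1 & hess2 g v <= s2]].

End Hessian.

Arguments hessian_polytope {R} n s0 s1 s2.

(* Main.v *)
Require Import Defs.
From HB Require Import structures.
From mathcomp Require Import all_boot all_order all_algebra.
From mathcomp Require Import all_classical all_reals all_analysis.
From mathcomp Require Import measurable_realfun zify ring lra.

Import Order.TTheory GRing.Theory Num.Theory.
Import numFieldNormedType.Exports.

Local Open Scope classical_set_scope.
Local Open Scope ring_scope.

(** Write N = n^2, let V_n be the volume of the polytope and a_n = ln V_n / N.
    The claim is that a_n converges to a limit between 0 and ln 2 + 1.

    Volumes are computed as iterated integrals [margs s f], in which the
    coordinates listed in [s] are integrated one after the other.  By Tonelli's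
    theorem the order of [s] is irrelevant, so that each estimate can take the
    order that suits it.  The Helmert coordinates are related to the values of
    the function by a chain of shears, which shows ([margs_thick]) that
    2 beta n V_n is the plain N-dimensional volume of the thickened polytope:
    the functions that satisfy the Hessian bounds and whose mean lies between
    -beta and beta.

    Lower bound.  A function with values between -1/2 and 1/2 has all its
    Hessians at most 2, so a unit cube lies in the thickened polytope and
    n V_n >= 1 ([volume_ge]).

    Upper bound.  Each family of Hessians sums to 0 and is bounded above, hence
    is bounded below as well; integrating twice along the torus bounds the
    functions themselves by a polynomial in n, [height]
    ([sub_hessian_bound]).  As the Hessians D_0 are at most 2 and sum to 0, the
    indicator of the polytope is at most e^N times the product of the
    exp ((D_0 - 2) / 2) over any set of rhombi.  When the vertices are
    integrated by decreasing first coordinate, every vertex outside of two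
    columns is the last vertex of a rhombus and contributes a factor 2, whereas
    the other 2 n vertices contribute a power of [height] whose logarithm is
    o(N) ([margs_thick_le]).  Hence limsup a_n <= ln 2 + 1.

    Convergence.  Fix m.  On the torus of side m, call frame the union of two
    consecutive columns and two consecutive rows.  For some choice of the values
    on the frame, the functions of the polytope with these values form a fibre
    of volume at least V_m exp (- O (m ln m)) ([exists_fibre]).  Functions that
    agree on the frame can be laid side by side, independently of each other,
    because a rhombus that meets two tiles lies in one of them together with the
    frame of its neighbours.  To fit such a tiling of the plane into a torus of
    any large side n, it is multiplied by a function that decreases to 0 at the
    seam with slope 1 / K; this spoils the Hessian bounds by O (height / K)
    only, where K depends on m but not on n.  Shrinking everything by the factor
    1 - 1 / m makes room for this error, and for an independent perturbation of
    size 1 / (2 m) at each vertex that lies on a frame or near the seam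
    ([glued_thick], [margs_glued]).
    Therefore liminf a_n >= a_m - glue_error m for every m ([near_log_density]),
    and since glue_error m tends to 0 the sequence converges
    ([cvg_almost_superadditive]). *)

Set Implicit Arguments.
Unset Strict Implicit.
Unset Printing Implicit Defensive.

(** * Iterated integrals on a space of functions *)

Definition evaluations (R : realType) (T : Type) : set (set (T -> R)) :=
  \bigcup_(x in [set: T]) preimage_set_system setT
    (fun g : T -> R => g x) (@measurable _ (measurableTypeR R)).

Local Notation fspace R T := (g_sigma_algebraType (@evaluations R T)).

Section FunctionSpace.
Context {R : realType}.

Lemma measurable_eval (T : Type) (x : T) :
  measurable_fun [set: fspace R T] (fun g : fspace R T => (g x : measurableTypeR R)).
Proof.
move=> _ B mB; apply: sub_sigma_algebra; exists x => //; by exists B.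
Qed.

Lemma measurable_fspace d (S : measurableType d) (T : Type) (h : S -> fspace R T) :
  (forall x, measurable_fun setT (fun t => (h t x : measurableTypeR R))) ->
  measurable_fun setT h.
Proof.
move=> mh; apply: (@measurability _ _ S (fspace R T) setT h (@evaluations R T)) => //.
move=> _ [_ [x _ [B mB <-]] <-]; rewrite !setTI.
by have := mh x measurableT B mB; rewrite setTI.
Qed.

Section Marginals.
Context {T : eqType}.
Implicit Types (g : T -> R) (x : T) (s : seq T) (f : fspace R T -> \bar R).

Definition upd g x (y : R) : T -> R := fun z => if z == x then y else g z.

Definition marg x f : fspace R T -> \bar R :=
  fun g => (\int[@lebesgue_measure R]_y f (upd g x y))%E.

Definition margs s f := foldr marg f s.

Definition pmeas f := measurable_fun setT f /\ forall g, (0 <= f g)%E.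

Lemma measurable_upd x :
  measurable_fun setT
    (fun p : fspace R T * measurableTypeR R => (upd p.1 x p.2 : fspace R T)).
Proof.
apply: measurable_fspace => z; rewrite /upd.
case: (z == x); first exact: measurable_snd.
exact: (measurableT_comp (measurable_eval z) measurable_fst).
Qed.

Lemma measurable_updr g x :
  measurable_fun setT (fun y : measurableTypeR R => (upd g x y : fspace R T)).
Proof.
apply: measurable_fspace => z; rewrite /upd.
by case: (z == x).
Qed.

Lemma pmeas_marg x f : pmeas f -> pmeas (marg x f).
Proof.
move=> [mf f0]; split; last by move=> g; apply: integral_ge0 => y _.
apply: (measurable_fun_fubini_tonelli_F
  (fun p : fspace R T * measurableTypeR R => f (upd p.1 x p.2))) => //.
exact: (measurableT_comp mf (measurable_upd x)).
Qed.

Lemma pmeas_margs s f : pmeas f -> pmeas (margs s f).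
Proof. by move=> pf; elim: s => //= x s IH; exact: pmeas_marg. Qed.

Lemma updC g x x' y y' : x != x' ->
  upd (upd g x y) x' y' = upd (upd g x' y') x y.
Proof.
move=> xx'; apply/funext => z; rewrite /upd.
by case: eqVneq => [->|//]; rewrite eq_sym (negbTE xx').
Qed.

Lemma upd_upd g x y y' : upd (upd g x y) x y' = upd g x y'.
Proof. by apply/funext => z; rewrite /upd; case: eqP. Qed.

(** Tonelli's theorem. *)
Lemma margC x x' f : pmeas f -> marg x (marg x' f) = marg x' (marg x f).
Proof.
move=> [mf f0]; have [->//|xx'] := eqVneq x x'.
apply/funext => g; rewrite /marg.
rewrite (fubini_tonelli
  (fun p : measurableTypeR R * measurableTypeR R =>
     f (upd (upd g x p.1) x' p.2))) //=.
- by apply: eq_integral => y _; apply: eq_integral => y' _; rewrite updC.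
- apply: (measurableT_comp mf); apply: measurable_fspace => z; rewrite /upd.
  case: (z == x'); first exact: measurable_snd.
  by case: (z == x) => //; exact: measurable_fst.
Qed.

Lemma margs_cat s s' f : margs (s ++ s') f = margs s (margs s' f).
Proof. exact: foldr_cat. Qed.

Lemma margs_margC x s f : pmeas f -> margs s (marg x f) = marg x (margs s f).
Proof.
move=> pf; elim: s => //= x' s ->; rewrite margC//; exact: pmeas_margs.
Qed.

Lemma perm_margs s s' f : pmeas f -> perm_eq s s' -> margs s f = margs s' f.
Proof.
move=> pf; elim: s s' => [|x s IH] s' ss'.
  by move: ss'; rewrite perm_sym => /perm_nilP ->.
have xs' : x \in s' by rewrite -(perm_mem ss') mem_head.
case/splitPr: xs' ss' => s1 s2 ss'.
have {}ss' : perm_eq s (s1 ++ s2).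
  by rewrite -(perm_cons x) (perm_trans ss')// (perm_catCA s1 [:: x] s2).
rewrite /= (IH _ ss') !margs_cat /= margs_margC//; exact: pmeas_margs.
Qed.

(** Only functions that agree with [g] off [s] are ever evaluated, hence the
    restricted comparison hypothesis. *)
Lemma le_margs s f f' g : pmeas f -> pmeas f' ->
  (forall g', (forall x, x \notin s -> g' x = g x) -> (f g' <= f' g')%E) ->
  (margs s f g <= margs s f' g)%E.
Proof.
move=> pf pf'; elim: s g => [|x s IH] g ff' /=; first exact: ff'.
have [m1 p1] := pmeas_margs s pf; have [m2 p2] := pmeas_margs s pf'.
apply: ge0_le_integral => //.
- exact: (measurableT_comp m1 (measurable_updr g x)).
- exact: (measurableT_comp m2 (measurable_updr g x)).
move=> y _; apply: IH => g' g'E; apply: ff' => z.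
rewrite inE negb_or => /andP[zx zs]; rewrite g'E// /upd; by rewrite (negbTE zx).
Qed.

Definition indep s f := forall x, x \in s -> forall g y, f (upd g x y) = f g.

Lemma margs_indepM s (h f : fspace R T -> \bar R) g :
  (forall g, 0 <= h g)%E -> indep s h -> pmeas f ->
  margs s (fun g => h g * f g)%E g = (h g * margs s f g)%E.
Proof.
move=> h0 + pf; elim: s g => [//|x s IH] g hs /=.
have [m1 p1] := pmeas_margs s pf.
rewrite /marg -ge0_integralZl//; last first.
  exact: (measurableT_comp m1 (measurable_updr g x)).
apply: eq_integral => y _; rewrite IH ?hs ?mem_head//.
by move=> z zs; apply: hs; rewrite inE zs orbT.
Qed.

Lemma margs_off s f g g' : (forall x, x \notin s -> g x = g' x) ->
  margs s f g = margs s f g'.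
Proof.
elim: s g g' => [|x s IH] g g' gg' /=.
  by congr f; apply/funext => x; exact: gg'.
apply: eq_integral => y _; apply: IH => z zs; rewrite /upd.
by case: eqVneq => // zx; apply: gg'; rewrite inE negb_or zx.
Qed.

(** A positive iterated integral exhibits a point: this turns an estimate of the
    volume of a fibre into an element of it. *)
Lemma margs_exists s f g : (0 < margs s f g)%E ->
  exists2 g', (forall x, x \notin s -> g' x = g x) & f g' != 0%E.
Proof.
move=> + ; apply: contraPP => nex.
have f0 g' : (forall x, x \notin s -> g' x = g x) -> f g' = 0%E.
  by move=> g'E; apply/eqP; apply: contra_notT nex => fg'; exists g'.
rewrite (_ : margs s f g = 0%E) ?ltxx//.
elim: s g {nex} f0 => [|x s IH] g f0 /=; first exact: f0.
rewrite /marg integral0_eq// => y _; apply: IH => g' g'E.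
apply: f0 => z; rewrite inE negb_or => /andP[zx zs].
by rewrite g'E// /upd (negbTE zx).
Qed.

End Marginals.
End FunctionSpace.

(** * Changes of variables *)

Section ChangeOfVariables.
Context {R : realType}.
Local Notation mu := (@lebesgue_measure R).

Let affine (a b : R) : measurableTypeR R -> measurableTypeR R := fun y => a * y + b.

Let measurable_affine a b : measurable_fun setT (affine a b).
Proof. by apply: measurable_funD => //; exact: measurable_funM. Qed.

(** Both sides are measures in [A], so that it is enough to compare them on
    intervals. *)
Let affine_preimage_measure (a b : R) (A : set (measurableTypeR R)) : a != 0 ->
  measurable A -> mu A = (`|a|%:E * mu (affine a b @^-1` A))%E.
Proof.
move=> a0 mA.
pose mp := measurable_affine a b.
pose nu := measure_function_pushforward__canonical__measure_function_Measure
  (mu : {measure set _ -> \bar R}) mp.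
pose k : {nonneg R} := NngNum (normr_ge0 a).
rewrite (@lebesgue_measure_unique _ (mscale k nu : {measure set _ -> \bar R}))//.
move=> _ [[x y] _ <-] /=.
rewrite /mscale/= /pushforward -[LHS]/(mu [set` `]x, y]]) lebesgue_measure_itv/=.
have [a_gt0|a_lt0|/eqP] := ltgtP 0 a; last by rewrite eq_sym (negbTE a0).
- rewrite (_ : affine a b @^-1` _ = [set` `](x - b) / a, (y - b) / a]]); last first.
    apply/seteqP; split => z /=; rewrite /affine !in_itv/=.
      by rewrite ltr_pdivrMr// ler_pdivlMr// ltrBlDr lerBrDr mulrC.
    by rewrite ltr_pdivrMr// ler_pdivlMr// ltrBlDr lerBrDr mulrC.
  rewrite lebesgue_measure_itv/= !lte_fin ltr_pM2r ?invr_gt0// ltrD2r.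
  case: ifPn => _; last by rewrite mule0.
  by rewrite -!EFinB -EFinM gtr0_norm//; congr EFin; field.
- rewrite (_ : affine a b @^-1` _ = [set` `[(y - b) / a, (x - b) / a[]); last first.
    apply/seteqP; split => z /=; rewrite /affine !in_itv/=.
      by rewrite ltr_ndivlMr// ler_ndivrMr// ltrBlDr lerBrDr mulrC andbC.
    by rewrite ltr_ndivlMr// ler_ndivrMr// ltrBlDr lerBrDr mulrC andbC.
  rewrite lebesgue_measure_itv/= !lte_fin ltr_nM2r ?invr_lt0// ltrD2r.
  case: ifPn => _; last by rewrite mule0.
  by rewrite -!EFinB -EFinM ltr0_norm//; congr EFin; field; rewrite lt_eqF.
Qed.

Lemma ge0_integral_affine (f : R -> \bar R) (a b : R) : a != 0 ->
  measurable_fun setT (f : measurableTypeR R -> \bar R) ->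
  (forall y, 0 <= f y)%E ->
  (\int[mu]_y f (a * y + b)%R = `|a|^-1%:E * \int[mu]_y f y)%E.
Proof.
move=> a0 mf f0.
pose mp := measurable_affine a b.
pose nu := measure_function_pushforward__canonical__measure_function_Measure
  (mu : {measure set _ -> \bar R}) mp.
pose k : {nonneg R} := NngNum (normr_ge0 a).
have na : `|a| != 0 by rewrite normr_eq0.
transitivity (\int[nu]_y f y)%E.
  by rewrite [RHS]ge0_integral_pushforward.
transitivity (`|a|^-1%:E * (`|a|%:E * \int[nu]_y f y))%E.
  by rewrite muleA -EFinM mulVf// mul1e.
congr (_ * _)%E.
rewrite -[X in (X * _)%E]/(k%:num%:E) -ge0_integral_mscale//.
apply: eq_measure_integral => A mA _.
have := affine_preimage_measure b a0 mA; exact.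
Qed.

(** The coordinates [iota x] of the larger space play the role of the
    coordinates [x], up to the factor [kappa].  The hypothesis
    constrains [Theta] one moving coordinate at a time, so that it may freeze
    some values and discard others. *)
Lemma margs_reindex (T T' : eqType) (iota : T -> T') (kappa : R) (s : seq T)
    (Theta : (T' -> R) -> T -> R) (f : fspace R T -> \bar R) (g : T' -> R) :
  kappa != 0 -> pmeas f ->
  (forall x, x \in s -> forall h y,
    Theta (upd h (iota x) y) = upd (Theta h) x (kappa * y)) ->
  margs (map iota s) (f \o Theta) g =
  (((`|kappa|^-1) ^+ size s)%:E * margs s f (Theta g))%E.
Proof.
move=> k0 pf; elim: s g => [|x s IH] g hT /=; first by rewrite expr0 mul1e.
have [m1 p1] := pmeas_margs s pf.
rewrite /marg; transitivity
  (\int[mu]_y ((`|kappa|^-1 ^+ size s)%:E *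
     margs s f (upd (Theta g) x (kappa * y + 0)%R)))%E.
  apply: eq_integral => y _; rewrite IH ?hT ?mem_head// ?addr0//.
  by move=> z zs; apply: hT; rewrite inE zs orbT.
rewrite ge0_integralZl//; last first.
  exact: (measurableT_comp (measurableT_comp m1 (measurable_updr (Theta g) x))
    (measurable_affine kappa 0)).
rewrite (@ge0_integral_affine (fun y => margs s f (upd (Theta g) x y)))//.
  by rewrite muleA -EFinM exprSr.
exact: (measurableT_comp m1 (measurable_updr (Theta g) x)).
Qed.

(** The elementary triangular change of variables: with [x] integrated first,
    the substitution is affine in one real variable. *)
Lemma margs_shear (T : eqType) (s : seq T) (x : T) (a : R) (b : (T -> R) -> R)
    (f : fspace R T -> \bar R) (g : T -> R) :
  a != 0 -> x \in s -> pmeas f ->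
  pmeas (fun h : fspace R T => f (upd h x (a * h x + b h))) ->
  (forall h y, b (upd h x y) = b h) ->
  margs s (fun h => f (upd h x (a * h x + b h))) g =
  (`|a|^-1%:E * margs s f g)%E.
Proof.
move=> a0 xs pf pfE bE.
have ps := perm_to_rem xs.
rewrite !(perm_margs _ ps)//= -!margs_margC//.
rewrite -(@margs_indepM _ _ _ (fun=> `|a|^-1%:E))//; last exact: pmeas_marg.
congr (margs _ _ g); apply/funext => h; rewrite /marg.
rewrite -(@ge0_integral_affine (fun y => f (upd h x y)) a (b h))//.
- by apply: eq_integral => y _; rewrite upd_upd bE /upd eqxx.
- by case: pf => mf _; exact: (measurableT_comp mf (measurable_updr h x)).
- by case: pf.
Qed.

Fixpoint upds (T : eqType) (g : T -> R) (s : seq T) (t : seq R) : T -> R :=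
  if s is x :: s' then upds (upd g x (head 0 t)) s' (behead t) else g.

(** The product measure is itself defined by integration over the first factor,
    which matches the head of the list of coordinates. *)
Lemma lebesgue_tuple_margs (T : eqType) m (s : seq T) (A : set (fspace R T))
    (g : T -> R) : size s = m -> measurable A ->
  lebesgue_tuple [set t : m.-tuple (measurableTypeR R) | A (upds g s t)] =
  margs s (EFin \o \1_A) g.
Proof.
move=> sm mA; elim: m s g sm => [|m IH] [|x s]// g [sm] /=.
rewrite /pushforward /product_measure1 /marg.
apply: eq_integral => y _; rewrite -IH//=; congr lebesgue_tuple.
apply/seteqP; split => t /=; rewrite /xsection/= ?inE//.
Qed.

End ChangeOfVariables.

(** * From Helmert coordinates to values *)

Section Measurability.
Context {R : realType}.

Lemma measurable_lin_comb (T' : Type) (I : Type) (r : seq I) (c : I -> R) (x : I -> T') :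
  measurable_fun setT
    (fun g : fspace R T' => (\sum_(i <- r) g (x i) * c i : measurableTypeR R)).
Proof.
apply: measurable_sum => i; apply: measurable_funM => //; exact: measurable_eval.
Qed.

Lemma pmeas_indic (T' : eqType) (A : set (fspace R T')) : measurable A ->
  pmeas (EFin \o (\1_A : fspace R T' -> R)).
Proof.
move=> mA; split; first exact/measurable_EFinP/measurable_indic.
by move=> g; rewrite lee_fin.
Qed.

Lemma integral_ball (B : R) : 0 <= B ->
  (\int[@lebesgue_measure R]_y (\1_[set y : R | (`|y| <= B)%R] y)%:E = (2 * B)%:E)%E.
Proof.
move=> B0.
have E : [set y : R | `|y| <= B] = [set` `[- B, B]].
  by apply/seteqP; split => y /=; rewrite in_itv/= ler_norml.
rewrite E integral_indic// setIT.
rewrite -[LHS]/(lebesgue_measure ([set` `[- B, B]] : set R)).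
rewrite lebesgue_measure_itv/= lte_fin -EFinB opprK mulr_natl -mulr2n.
case: ifPn => //; rewrite -leNgt => bN.
have -> : B = 0 by apply/eqP; rewrite eq_le B0 andbT; lra.
by rewrite mul0rn.
Qed.

Lemma measurable_ball (B : R) :
  measurable ([set y : R | `|y| <= B] : set (measurableTypeR R)).
Proof.
rewrite (_ : mkset _ = [set` `[- B, B]]); first exact: measurable_itv.
by apply/seteqP; split => y /=; rewrite in_itv/= ler_norml.
Qed.

End Measurability.

(** Functions on [T] are listed as sequences through [enum_rank].  Position 0
    first holds the mean and position k + 1 the k-th Helmert coordinate; the
    maps [E 1], ..., [E N.-1], [E 0] then replace these entries one by one by
    the values of the function.  Since the k-th Helmert vector vanishes beyond
    rank k + 1, the value at rank j involves only the coordinates k >= j - 1,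
    which [E 1], ..., [E j.-1] have left in place: every step is a shear. *)
Section Helmert.
Context {R : realType} (T : finType).
Local Notation N := #|T|.
Hypothesis T0 : (0 < N)%N.

Let hm (k j : nat) : R :=
  ((j <= k)%N%:R - k.+1%:R * (j == k.+1)%:R) / Num.sqrt (k.+1 * k.+2)%:R.

Let L (g : nat -> R) (j : nat) : R := g 0%N + \sum_(0 <= k < N.-1) g k.+1 * hm k j.

(** Pivot and remaining part of the step [E j].  The steps j >= 1 substitute row
    j of the Helmert matrix.  The last one recovers the value at rank 0 from the
    mean and the other values: it is N times the mean minus their sum. *)
Let a (j : nat) : R := if j is j'.+1 then hm j' j'.+1 else N%:R.
Let b (j : nat) (g : nat -> R) : R :=
  if j is j'.+1 then g 0%N * 1 + \sum_(j <= k < N.-1) g k.+1 * hm k j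
  else \sum_(1 <= i < N) g i * (-1).

Let E (j : nat) (g : nat -> R) : nat -> R := upd g j (a j * g j + b j g).
Let comp (j : nat) (g : nat -> R) : nat -> R := foldl (fun h i => E i h) g (iota 1 j).

Let compS j g : comp j.+1 g = E j.+1 (comp j g).
Proof. by rewrite /comp -(addn1 j) iotaD foldl_cat addn1. Qed.

Let L_row j g : (0 < j <= N.-1)%N -> L g j = a j * g j + b j g.
Proof.
case: j => [//|j] /andP[_ jN]; rewrite /L /a /b mulr1 addrCA; congr (_ + _).
rewrite (@big_cat_nat _ _ _ j)//=; last exact: ltnW.
rewrite big_nat_cond big1 ?add0r => [|k /andP[/andP[_ kj] _]]; last first.
  by rewrite /hm leqNgt ltnS (ltnW kj) /= eqSS gtn_eqF// mulr0 subrr mul0r mulr0.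
by rewrite big_ltn// [in LHS]mulrC.
Qed.

Let compE j g i : (j <= N.-1)%N ->
  comp j g i = if (0 < i <= j)%N then L g i else g i.
Proof.
elim: j g i => [|j IH] g i jN; first by case: i.
rewrite compS /E /upd; have [->|ij] := eqVneq i j.+1.
  rewrite ltnSn L_row//; congr (_ * _ + _).
    by rewrite IH ?(ltnW jN)// ltnn andbF.
  rewrite /b IH ?(ltnW jN)//=; congr (_ + _); apply: eq_big_nat => k /andP[jk _].
  by rewrite IH ?(ltnW jN)//= [(k < j)%N]ltnNge (ltnW jk).
by rewrite IH ?(ltnW jN)// [(i <= j.+1)%N]leq_eqVlt (negbTE ij) ltnS.
Qed.

Let sum_rank (F : nat -> R) : \sum_(x : T) F (enum_rank x) = \sum_(0 <= j < N) F j.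
Proof.
rewrite big_mkord (reindex_onto (@enum_val T T) (@enum_rank T))/=; last first.
  by move=> x _; rewrite enum_rankK.
by apply: eq_big => [i|i _]; rewrite enum_valK ?eqxx.
Qed.

Let sum_hm k : (k < N.-1)%N -> \sum_(0 <= j < N) hm k j = 0.
Proof.
move=> kN; rewrite -sum_rank -[RHS](@helmert_mean_zero R T (Ordinal kN)).
by apply: eq_bigr.
Qed.

Let sum_L g : \sum_(0 <= j < N) L g j = N%:R * g 0%N.
Proof.
rewrite big_split/= sumr_const_nat subn0 mulr_natl exchange_big_nat/=.
rewrite [X in _ + X]big_nat_cond [X in _ + X]big1 ?addr0// => k /andP[/andP[_ kN] _].
by rewrite -mulr_sumr sum_hm// mulr0.
Qed.

Let L_comp g i : (i < N)%N -> E 0 (comp N.-1 g) i = L g i.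
Proof.
move=> iN; rewrite /E /upd; case: i iN => [_|i iN] /=; last first.
  have {}iN : (i.+1 <= N.-1)%N by rewrite -ltnS prednK.
  by rewrite compE// iN.
rewrite compE//= -sum_L -mulr_suml mulrN1 [X in X + _]big_ltn//.
rewrite (@eq_big_nat _ _ _ 1%N N (comp N.-1 g) (L g)) ?addrK// => i /andP[i0 iN].
have {}iN : (i <= N.-1)%N by rewrite -ltnS prednK.
by rewrite compE// i0 iN.
Qed.

Let measurable_E j : measurable_fun setT (E j : fspace R nat -> fspace R nat).
Proof.
apply: measurable_fspace => i; rewrite /E /upd.
case: (i == j); last exact: measurable_eval.
apply: measurable_funD.
  by apply: measurable_funM => //; exact: measurable_eval.
case: j => [|j]; first exact: measurable_lin_comb.
apply: measurable_funD; last exact: measurable_lin_comb.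
by apply: measurable_funM => //; exact: measurable_eval.
Qed.

Let pmeas_E j (f : fspace R nat -> \bar R) : pmeas f -> pmeas (f \o E j).
Proof.
move=> [mf f0]; split; last by move=> g; exact: f0.
exact: (@measurableT_comp _ _ _ (fspace R nat) (fspace R nat) _ f _ (E j) mf (measurable_E j)).
Qed.

Let b_upd j h y : b j (upd h j y) = b j h.
Proof.
rewrite /b; case: j => [|j].
  by apply: eq_big_nat => i /andP[i0 _]; rewrite /upd gtn_eqF.
rewrite /upd/=; congr (_ + _); apply: eq_big_nat => k /andP[jk _].
by rewrite eqSS gtn_eqF.
Qed.

Let a_neq0 j : a j != 0.
Proof.
case: j => [|j]; first by rewrite pnatr_eq0 -lt0n.
rewrite /a /hm ltnn eqxx mulr1 sub0r mulf_neq0// ?oppr_eq0 ?pnatr_eq0//.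
Qed.

Let margs_E j f g : (j < N)%N -> pmeas f ->
  margs (iota 0 N) (f \o E j) g = (`|a j|^-1%:E * margs (iota 0 N) f g)%E.
Proof.
move=> jN pf; apply: (@margs_shear _ _ _ j (a j) (b j)) => //.
  by rewrite mem_iota.
exact: pmeas_E.
Qed.

(** The product telescopes.  With the pivot N of [E 0], the whole chain has
    determinant N / sqrt N = sqrt N up to sign. *)
Let prod_a j : \prod_(1 <= i < j.+1) `|a i|^-1 = Num.sqrt j.+1%:R.
Proof.
elim: j => [|j IH]; first by rewrite big_geq// sqrtr1.
rewrite big_nat_recr//= IH /hm ltnn eqxx mulr1 sub0r mulNr normrN.
rewrite ger0_norm ?divr_ge0// invf_div natrM sqrtrM// mulrCA.
have s0 : Num.sqrt j.+1%:R != 0 :> R by rewrite gt_eqF// sqrtr_gt0.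
rewrite -[X in _ / X](@sqr_sqrtr R j.+1%:R)//; field; exact: s0.
Qed.

Let margs_comp j f g : (j <= N.-1)%N -> pmeas f ->
  margs (iota 0 N) (f \o comp j) g =
  ((\prod_(1 <= i < j.+1) `|a i|^-1)%:E * margs (iota 0 N) f g)%E.
Proof.
elim: j f => [|j IH] f jN pf; first by rewrite big_geq// mul1e.
rewrite (_ : f \o comp j.+1 = (f \o E j.+1) \o comp j); last first.
  by apply/funext => h /=; rewrite compS.
rewrite IH ?(ltnW jN)//; last exact: pmeas_E.
rewrite margs_E//; last by rewrite -(prednK T0) ltnS.
by rewrite muleA -EFinM [in RHS]big_nat_recr.
Qed.

Let upds_iota (g : nat -> R) i m (t : seq R) z : size t = m ->
  upds g (iota i m) t z = if (i <= z < i + m)%N then nth 0 t (z - i) else g z.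
Proof.
elim: m i g t => [|m IH] i g [|y t]//= => [_|[tm]].
  by rewrite addn0; case: ltngtP.
rewrite IH// /upd addSnnS; case: ltngtP => //= [iz|->].
  by rewrite -(subnSK iz).
by rewrite subnn -addSnnS leq_addr.
Qed.

Variables (U : set (fspace R T)) (beta : R).
Hypothesis mU : measurable U.
Hypothesis UC : forall g c, U g -> U (fun x => g x + c).
Hypothesis beta0 : 0 <= beta.

Let Res (g : nat -> R) : T -> R := fun x => g (enum_rank x).

(** The slab of functions of mean at most [beta] in absolute value turns a
    volume in the hyperplane of mean-zero functions into a volume in the whole
    space. *)
Definition thick : set (fspace R T) := U `&` [set g | `|\sum_x g x| <= beta * N%:R].

Lemma measurable_thick : measurable thick.
Proof.
apply: measurableI => //; rewrite -[X in measurable X]setTI.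
have mS : measurable_fun setT
    (fun g : fspace R T => (\sum_x g x : measurableTypeR R)).
  by apply: measurable_sum => x; exact: measurable_eval.
exact: (mS measurableT _ (measurable_ball (beta * N%:R))).
Qed.

Let measurable_Res : measurable_fun setT (Res : fspace R nat -> fspace R T).
Proof. by apply: measurable_fspace => x; exact: measurable_eval. Qed.

Let F' : fspace R nat -> \bar R := (EFin \o \1_thick) \o Res.

Let pmeas_F' : pmeas F'.
Proof.
have [mf f0] := pmeas_indic measurable_thick.
split; last by move=> g; exact: f0.
exact: (@measurableT_comp _ _ _ (fspace R nat) (fspace R T) _ (EFin \o \1_thick) _ Res
   mf measurable_Res).
Qed.

Let tail (g : nat -> R) : T -> R :=
  fun x => \sum_(0 <= k < N.-1) g k.+1 * hm k (enum_rank x).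

Let sum_tail g : \sum_x tail g x = 0.
Proof.
rewrite exchange_big/= big_nat_cond big1// => k /andP[/andP[_ kN] _].
by rewrite -mulr_sumr (sum_rank (hm k)) sum_hm// mulr0.
Qed.

Let measurable_tail : measurable_fun setT (tail : fspace R nat -> fspace R T).
Proof. by apply: measurable_fspace => x; exact: measurable_lin_comb. Qed.

Let A : set (fspace R nat) := [set g | U (tail g)].

Let measurable_A : measurable A.
Proof.
by rewrite -[A]setTI; exact: (measurable_tail measurableT mU).
Qed.

(** Since [U] is invariant under constants, the constraints on the mean and on
    the mean-zero part separate. *)
Let F'_L g : F' (L g) = ((\1_[set y : R | `|y| <= beta] (g 0%N))%:E * (\1_A g)%:E)%E.
Proof.
rewrite /F' /= -EFinM !indicE -natrM mulnb; congr ((nat_of_bool _)%:R%:E).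
have ResL : Res (L g) = fun x => tail g x + g 0%N.
  by apply/funext => x; rewrite addrC.
have sumL : \sum_x Res (L g) x = g 0%N * N%:R.
  by rewrite ResL big_split/= sum_tail add0r sumr_const mulr_natr.
apply/idP/andP => [|[]]; rewrite !inE /thick /A /=.
  rewrite sumL normrM [ `|N%:R| ]ger0_norm// ler_pM2r ?ltr0n//.
  move=> [Ug ->]; split => //.
  have := UC (- g 0%N) Ug; rewrite ResL; congr U.
  by apply/funext => x; rewrite addrK.
rewrite sumL normrM [ `|N%:R| ]ger0_norm// ler_pM2r ?ltr0n// ResL.
by move=> ? ?; split => //; exact: UC.
Qed.

Let mean_zero_volumeE g :
  mean_zero_volume (U `&` [set g | \sum_x g x = 0]) =
  margs (iota 1 N.-1) (EFin \o \1_A) g.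
Proof.
rewrite -(@lebesgue_tuple_margs R nat N.-1) ?size_iota//.
rewrite /mean_zero_volume; congr lebesgue_tuple.
have ofE t : of_helmert_coord t = tail (upds g (iota 1 N.-1) t) :> (T -> R).
  apply/funext => x; rewrite /of_helmert_coord /tail big_mkord.
  apply: eq_bigr => k _; rewrite upds_iota ?size_tuple//= add1n ltnS ltn_ord.
  by rewrite subn1 (tnth_nth 0).
apply/seteqP; split => t /=; rewrite ofE; first by move=> [].
by move=> ?; split => //; exact: sum_tail.
Qed.

(** The length of the slab is [2 * beta * sqrt N] because the constant function 1
    has norm sqrt N. *)
Lemma margs_thick g0 : margs (enum T) (EFin \o \1_thick) g0 =
  ((2 * beta * Num.sqrt N%:R)%:E *
   mean_zero_volume (U `&` [set g | (\sum_x g x = 0)%R]))%E.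
Proof.
pose g : nat -> R := fun=> 0.
have F'E : margs (enum T) (EFin \o \1_thick) g0 = margs (iota 0 N) F' g.
  rewrite (_ : iota 0 N = map (fun x : T => val (enum_rank x)) (enum T)); last first.
    apply: (@eq_from_nth _ 0%N); first by rewrite size_iota size_map -cardE.
    move=> i; rewrite size_iota => iN.
    have x0 : T by move: T0; rewrite cardE; case: (enum T) => [|x _] //.
    rewrite nth_iota// (nth_map x0) -?cardE//.
    by have := enum_valK (Ordinal iN); rewrite (enum_val_nth x0) => ->.
  rewrite (@margs_reindex _ _ _ _ 1)//.
  - rewrite normr1 invr1 expr1n mul1e; apply: margs_off => x.
    by rewrite mem_enum.
  - exact: pmeas_indic measurable_thick.
  - move=> x _ h y; apply/funext => z; rewrite /Res /upd mul1r.
    by rewrite (inj_eq val_inj) (inj_eq enum_rank_inj).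
have : margs (iota 0 N) (F' \o L) g = ((Num.sqrt N%:R)^-1%:E * margs (iota 0 N) F' g)%E.
  have -> : F' \o L = (F' \o E 0) \o comp N.-1.
    apply/funext => h /=; rewrite /F' /=; congr ((\1_thick _)%:E).
    by apply/funext => x; rewrite /Res L_comp.
  rewrite margs_comp//; last exact: pmeas_E.
  rewrite margs_E// muleA -EFinM prod_a prednK//=; congr (_%:E * _)%E.
  rewrite ger0_norm// -[X in _ / X](@sqr_sqrtr R N%:R)// expr2 invfM mulrA divff ?mul1r//.
  by rewrite gt_eqF// sqrtr_gt0 ltr0n.
rewrite F'E (_ : F' \o L = fun g =>
  (\1_[set y : R | `|y| <= beta] (g 0%N))%:E * (\1_A g)%:E)%E; last first.
  by apply/funext => h; exact: F'_L.
rewrite -(prednK T0) /= {1}/marg.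
set V := mean_zero_volume _.
have key y : margs (iota 1 N.-1) (fun g => (\1_[set y : R | `|y| <= beta] (g 0%N))%:E *
    (\1_A g)%:E)%E (upd g 0 y) = ((\1_[set y : R | `|y| <= beta] y)%:E * V)%E.
  rewrite (@margs_indepM _ _ _ (fun g => (\1_[set y : R | `|y| <= beta] (g 0%N))%:E)).
  - by rewrite -mean_zero_volumeE /upd eqxx.
  - by move=> h; rewrite lee_fin.
  - by move=> x; rewrite mem_iota => /andP[x1 _] h z; rewrite /upd ltn_eqF.
  - exact: pmeas_indic.
under eq_integral do rewrite key.
rewrite ge0_integralZr//; last 2 first.
- by apply/measurable_EFinP; apply: measurable_indic; exact: measurable_ball.
- exact: measure_ge0.
rewrite integral_ball// -(prednK T0).
set X := marg _ _ _ => VX.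
have sN : Num.sqrt N.-1.+1%:R != 0 :> R by rewrite gt_eqF// sqrtr_gt0 ltr0n.
transitivity ((Num.sqrt N.-1.+1%:R)%:E * ((Num.sqrt N.-1.+1%:R)^-1%:E * X))%E.
  by rewrite muleA -EFinM divff// mul1e.
by rewrite -VX muleA -EFinM mulrC.
Qed.

End Helmert.

(** * Functions on the torus with bounded Hessian *)

Section Torus.
Context {R : realType} (n : nat).
Implicit Types (g psi : torus n -> R) (v w : torus n).

Definition sub_hessian (s0 s1 s2 : R) : set (fspace R (torus n)) :=
  [set g | forall v, [/\ hess0 g v <= s0, hess1 g v <= s1 & hess2 g v <= s2]].

Let measurable_le_fun (h : fspace R (torus n) -> measurableTypeR R) (s : R) :
  measurable_fun setT h -> measurable [set g | h g <= s].
Proof.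
move=> mh; rewrite -[X in measurable X]setTI.
have -> : [set g | h g <= s] = h @^-1` [set` `]-oo, s]].
  by apply/seteqP; split => g /=; rewrite in_itv.
by apply: mh => //; exact: measurable_itv.
Qed.

Lemma measurable_hess0 v :
  measurable_fun setT (fun g : fspace R (torus n) => (hess0 g v : measurableTypeR R)).
Proof.
by case: v => x y; rewrite /hess0; do ?[apply: measurable_funB|apply: measurable_funD];
  exact: measurable_eval.
Qed.

Lemma measurable_sub_hessian s0 s1 s2 : measurable (sub_hessian s0 s1 s2).
Proof.
have -> : sub_hessian s0 s1 s2 = \bigcap_(v in [set: torus n])
   ([set g | hess0 g v <= s0] `&` ([set g | hess1 g v <= s1] `&`
    [set g | hess2 g v <= s2])).
  apply/seteqP; split => g /= gU v; first by move=> _; case: (gU v).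
  by have [//|? []] := gU v.
apply: fin_bigcap_measurable => [|v _]. exact: (@finite_finset (torus n)).
apply: measurableI; first by apply: measurable_le_fun; exact: measurable_hess0.
by apply: measurableI; apply: measurable_le_fun; case: v => x y;
  rewrite /hess1 /hess2; do ?[apply: measurable_funB|apply: measurable_funD];
  exact: measurable_eval.
Qed.

Lemma sub_hessianC s0 s1 s2 g c : sub_hessian s0 s1 s2 g ->
  sub_hessian s0 s1 s2 (fun v => g v + c).
Proof.
move=> gU [x y]; have [] := gU (x, y); rewrite /hess0 /hess1 /hess2 => h0 h1 h2.
by split; lra.
Qed.

Lemma hessian_polytopeE s0 s1 s2 : hessian_polytope n s0 s1 s2 =
  sub_hessian s0 s1 s2 `&` [set g | \sum_v g v = 0].
Proof. by apply/seteqP; split => g [? ?]; split. Qed.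

Lemma sum_shift (p : 'I_n -> 'I_n) (q : 'I_n -> 'I_n) (F : torus n -> R) :
  injective p -> injective q -> \sum_(v : torus n) F (p v.1, q v.2) = \sum_v F v.
Proof.
move=> ip iq; rewrite [RHS](reindex_inj (h := fun v => (p v.1, q v.2)))//.
by move=> [a b] [a' b'] [/ip -> /iq ->].
Qed.

Lemma ordS_inj : injective (@ordS n).
Proof. exact: can_inj (@ordSK n). Qed.

Let S2_inj : injective (fun a : 'I_n => ordS (ordS a)).
Proof. by move=> a b /ordS_inj /ordS_inj. Qed.

Let sum_S (g : torus n -> R) :
  (\sum_v g (ordS v.1, v.2) = \sum_v g v) * (\sum_v g (v.1, ordS v.2) = \sum_v g v) *
  (\sum_v g (ordS v.1, ordS v.2) = \sum_v g v) *
  (\sum_v g (ordS (ordS v.1), ordS v.2) = \sum_v g v) *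
  (\sum_v g (ordS v.1, ordS (ordS v.2)) = \sum_v g v).
Proof.
have i1 := ordS_inj; have i2 := S2_inj; have i0 : injective (@id 'I_n) by [].
split; [split; [split; [split|]|]|].
- exact (sum_shift g i1 i0).
- exact (sum_shift g i0 i1).
- exact (sum_shift g i1 i1).
- exact (sum_shift g i2 i1).
- exact (sum_shift g i1 i2).
Qed.

Lemma sum_hess0 g : \sum_v hess0 g v = 0.
Proof.
rewrite (eq_bigr (fun v => g v + g (ordS (ordS v.1), ordS v.2) - g (ordS v.1, v.2)
  - g (ordS v.1, ordS v.2))); last by case.
by rewrite !sumrB big_split/= !sum_S addrK subrr.
Qed.

Lemma sum_hess1 g : \sum_v hess1 g v = 0.
Proof.
rewrite (eq_bigr (fun v => g (ordS v.1, v.2) + g (v.1, ordS v.2) - g v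
  - g (ordS v.1, ordS v.2))); last by case.
by rewrite !sumrB big_split/= !sum_S addrK subrr.
Qed.

Lemma sum_hess2 g : \sum_v hess2 g v = 0.
Proof.
rewrite (eq_bigr (fun v => g v + g (ordS v.1, ordS (ordS v.2)) - g (ordS v.1, ordS v.2)
  - g (v.1, ordS v.2))); last by case.
by rewrite !sumrB big_split/= !sum_S addrK subrr.
Qed.

Local Notation N := (n ^ 2)%N.

(** One term is minus the sum of the others, which are at most [S]. *)
Lemma normr_le_of_sum0 (h : torus n -> R) (S : R) : 0 <= S ->
  (forall v, h v <= S) -> \sum_v h v = 0 -> forall v, `|h v| <= N%:R * S.
Proof.
move=> S0 hS h0 v.
have N1 : (0 < N)%N by rewrite -card_torus; apply/card_gt0P; exists v.
rewrite ler_norml; apply/andP; split; last first.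
  by rewrite (le_trans (hS v))// ler_peMl// ler1n.
move: h0; rewrite (bigD1 v)//= => /eqP; rewrite addr_eq0 => /eqP ->.
rewrite lerN2 (le_trans (ler_sum _ (fun w _ => hS w)))//.
rewrite sumr_const -[X in X <= _]mulr_natl ler_wpM2r// ler_nat -card_torus.
exact: max_card.
Qed.

Lemma val_iter_ordS k (a : 'I_n) : val (iter k (@ordS n) a) = ((a + k) %% n)%N :> nat.
Proof.
elim: k => [|k IH]; first by rewrite addn0 modn_small.
by rewrite iterS /= IH addnS -addn1 modnDml addn1.
Qed.

Lemma reach_ordS (a b : 'I_n) : exists2 k, (k < n)%N & iter k (@ordS n) a = b.
Proof.
have n0 : (0 < n)%N by apply: leq_trans (ltn_ord a).
exists ((b + (n - a)) %% n)%N; first by rewrite ltn_mod.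
apply: val_inj; rewrite val_iter_ordS modnDmr addnCA subnKC; last exact: ltnW.
by rewrite modnDr modn_small.
Qed.

(** A path that first follows one direction and then the other has at most
    2 n steps. *)
Lemma lipschitz_torus psi (K : R) : 0 <= K ->
  (forall a b, `|psi (ordS a, b) - psi (a, b)| <= K) ->
  (forall a b, `|psi (a, ordS b) - psi (a, b)| <= K) ->
  forall v w, `|psi v - psi w| <= 2 * n%:R * K.
Proof.
move=> K0 h1 h2 [a b] [a' b'].
have it1 k : `|psi (iter k (@ordS n) a', b) - psi (a', b)| <= k%:R * K.
  elim: k => [|k IH]; first by rewrite subrr normr0 mul0r.
  rewrite iterS -natr1 mulrDl mul1r.
  rewrite (le_trans (ler_distD (psi (iter k (@ordS n) a', b)) _ _))// addrC lerD//.
have it2 k : `|psi (a', iter k (@ordS n) b') - psi (a', b')| <= k%:R * K.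
  elim: k => [|k IH]; first by rewrite subrr normr0 mul0r.
  rewrite iterS -natr1 mulrDl mul1r.
  rewrite (le_trans (ler_distD (psi (a', iter k (@ordS n) b')) _ _))// addrC lerD//.
have [k kn ka] := reach_ordS a' a; have [l ln lb] := reach_ordS b' b.
have := it1 k; have := it2 l; rewrite ka lb => i2 i1.
rewrite (le_trans (ler_distD (psi (a', b)) _ _))//.
rewrite -mulrA mulr_natl mulr2n lerD//.
  by rewrite (le_trans i1)// ler_wpM2r// ler_nat ltnW.
by rewrite (le_trans i2)// ler_wpM2r// ler_nat ltnW.
Qed.

Lemma normr_le_of_mean psi (c D : R) : `|\sum_v psi v| <= c * N%:R ->
  (forall v w, `|psi v - psi w| <= D) -> forall v, `|psi v| <= D + c.
Proof.
move=> sc hD v.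
have N1 : (0 < N)%N by rewrite -card_torus; apply/card_gt0P; exists v.
have Nr : (0 : R) < N%:R by rewrite ltr0n.
rewrite -(ler_pM2r Nr) -{1}(@ger0_norm _ N%:R)// -normrM.
have -> : psi v * N%:R = \sum_w (psi v - psi w) + \sum_w psi w.
  by rewrite sumrB subrK sumr_const card_torus mulr_natr.
rewrite (le_trans (ler_normD _ _))// mulrDl lerD//.
rewrite (le_trans (ler_norm_sum _ _ _))//.
rewrite (le_trans (ler_sum _ (fun w _ => hD v w)))//.
by rewrite sumr_const card_torus mulr_natr.
Qed.

(** The polynomial bound of [sub_hessian_bound]: an upper bound n^2 S for the
    Hessians is integrated twice over paths of length O (n). *)
Definition height (S : R) : R := 8 * n%:R ^+ 4 * S + 1.

(** The Hessians are differences of the first differences [p1] and [p2] of [g]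
    along the lattice directions.  As [p1] and [p2] have mean zero,
    they are bounded, and then so is [g], whose mean is at most 1. *)
Lemma sub_hessian_bound s0 s1 s2 S g : 0 <= S -> s0 <= S -> s1 <= S -> s2 <= S ->
  sub_hessian s0 s1 s2 g -> `|\sum_v g v| <= 1 * N%:R ->
  forall v, `|g v| <= height S.
Proof.
move=> S0 s0S s1S s2S gU gm.
pose L : R := N%:R * S.
have L0 : 0 <= L by rewrite mulr_ge0.
have h0 v : `|hess0 g v| <= L.
  by apply: normr_le_of_sum0 => //; [move=> w; have [+ _ _] := gU w; lra|exact: sum_hess0].
have h1 v : `|hess1 g v| <= L.
  by apply: normr_le_of_sum0 => //; [move=> w; have [_ + _] := gU w; lra|exact: sum_hess1].
have h2 v : `|hess2 g v| <= L.
  by apply: normr_le_of_sum0 => //; [move=> w; have [_ _ +] := gU w; lra|exact: sum_hess2].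
pose p1 v := g (ordS v.1, v.2) - g v; pose p2 v := g (v.1, ordS v.2) - g v.
have p1B v : `|p1 v| <= 4 * n%:R * L + 0.
  apply: normr_le_of_mean.
    rewrite mul0r normr_le0 sumrB sum_S.
    by rewrite subrr.
  move=> {}v w; rewrite (_ : 4 * n%:R * L = 2 * n%:R * (2 * L)); last by ring.
  apply: lipschitz_torus => [|a b|a b]; first by rewrite mulr_ge0.
    have := h0 (a, b); have := h1 (ordS a, b); rewrite /hess0 /hess1 /p1/= !ler_norml.
    by move=> /andP[? ?] /andP[? ?]; apply/andP; split; lra.
  have := h1 (a, b); rewrite /hess1 /p1/= !ler_norml.
  by move=> /andP[? ?]; apply/andP; split; lra.
have p2B v : `|p2 v| <= 4 * n%:R * L + 0.
  apply: normr_le_of_mean.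
    rewrite mul0r normr_le0 sumrB sum_S.
    by rewrite subrr.
  move=> {}v w; rewrite (_ : 4 * n%:R * L = 2 * n%:R * (2 * L)); last by ring.
  apply: lipschitz_torus => [|a b|a b]; first by rewrite mulr_ge0.
    have := h1 (a, b); rewrite /hess1 /p2/= !ler_norml.
    by move=> /andP[? ?]; apply/andP; split; lra.
  have := h2 (a, b); have := h1 (a, ordS b); rewrite /hess1 /hess2 /p2/= !ler_norml.
  by move=> /andP[? ?] /andP[? ?]; apply/andP; split; lra.
move=> v; rewrite /height (_ : 8 * _ * S = 2 * n%:R * (4 * n%:R * L)); last first.
  by rewrite /L natrX; ring.
apply: normr_le_of_mean gm _ v => v w; apply: lipschitz_torus.
- by rewrite mulr_ge0.
- by move=> a b; have := p1B (a, b); rewrite addr0.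
- by move=> a b; have := p2B (a, b); rewrite addr0.
Qed.

End Torus.

(** * The upper bound *)

Section Product.
Context {R : realType} (T : eqType).
Local Notation mu := (@lebesgue_measure R).

(** Each weight is integrated with respect to its own coordinate, at a time when
    only weights of earlier coordinates remain; none of these depends on it. *)
Lemma margs_prod_le (r : rel T) (w : T -> (T -> R) -> R) (c : T -> R) (s : seq T)
    (g : T -> R) :
  (forall x, measurable_fun setT (w x : fspace R T -> measurableTypeR R)) ->
  (forall x h, 0 <= w x h) -> (forall x, 0 <= c x) ->
  (forall x x', r x x' -> forall h y, w x (upd h x' y) = w x h) ->
  (forall x h, x \in s -> (\int[mu]_y (w x (upd h x y))%:E <= (c x)%:E)%E) ->
  pairwise r s ->
  (margs s (fun h => (\prod_(x <- s) w x h)%:E) g <= (\prod_(x <- s) c x)%:E)%E.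
Proof.
move=> mw w0 c0 wr; elim: s g => [|x s IH] g wc /=; first by rewrite !big_nil.
case/andP => rx rs.
have mp (s' : seq T) : pmeas (fun h => (\prod_(x <- s') w x h)%:E).
  split; last by move=> h; rewrite lee_fin prodr_ge0.
  by apply/measurable_EFinP; apply: measurable_prod => x' _; exact: mw.
rewrite (_ : (fun h => _) = (fun h => (w x h)%:E * (\prod_(x <- s) w x h)%:E)%E); last first.
  by apply/funext => h; rewrite big_cons EFinM.
rewrite big_cons EFinM /marg.
have mwx h : measurable_fun setT (fun y : measurableTypeR R => (w x (upd h x y))%:E).
  apply/measurable_EFinP; exact: (measurableT_comp (mw x) (measurable_updr h x)).
apply: (@le_trans _ _ (\int[mu]_y ((w x (upd g x y))%:E * (\prod_(x <- s) c x)%:E))%E).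
  apply: ge0_le_integral => //.
  - move=> y _; apply: (pmeas_margs _ _).2; split.
      apply: emeasurable_funM; last exact: (mp s).1.
      by apply/measurable_EFinP; exact: mw.
    by move=> h; rewrite mule_ge0// lee_fin ?prodr_ge0.
  - apply: (measurableT_comp _ (measurable_updr g x)).
    apply: (pmeas_margs _ _).1; split.
      apply: emeasurable_funM; last exact: (mp s).1.
      by apply/measurable_EFinP; exact: mw.
    by move=> h; rewrite mule_ge0// lee_fin ?prodr_ge0.
  - exact: emeasurable_funM.
  - move=> y _; rewrite (@margs_indepM _ _ _ (fun h => (w x h)%:E))//.
    + apply: lee_wpmul2l; first by rewrite lee_fin.
      by apply: IH => // x' h xs; apply: wc; rewrite inE xs orbT.
    + by move=> h; rewrite lee_fin.
    + by move=> x' xs h z; rewrite (wr x x')// (allP rx).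
rewrite ge0_integralZr//; first last.
- by rewrite lee_fin prodr_ge0.
- by move=> y _; rewrite lee_fin.
by apply: lee_wpmul2r; [rewrite lee_fin prodr_ge0|apply: wc; rewrite mem_head].
Qed.

End Product.

Section HalfLine.
Context {R : realType}.
Local Notation mu := (@lebesgue_measure R).

(** The function exp ((d - 2) / 2) on d <= 2, and 0 beyond, as a reflected
    exponential density. *)
Definition expo (d : R) : R := 2 * exponential_pdf 2^-1 (2 - d).

Lemma expo_ge0 d : 0 <= expo d.
Proof. by rewrite mulr_ge0// exponential_pdf_ge0. Qed.

Lemma measurable_expo : measurable_fun setT (expo : measurableTypeR R -> measurableTypeR R).
Proof.
apply: measurable_funM => //.
apply: (measurableT_comp (measurable_exponential_pdf _)) => //.
exact: measurable_funB.
Qed.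

Lemma expoE d : d <= 2 -> expo d = expR ((d - 2) / 2).
Proof.
move=> d2; rewrite /expo exponential_pdfE ?subr_ge0// mulrA divff// mul1r.
by congr expR; field.
Qed.

Lemma integral_expo (e : R) : (\int[mu]_y (expo (y + e))%:E = 2%:E)%E.
Proof.
have m0 : measurable_fun setT (fun y : measurableTypeR R => (expo y)%:E).
  by apply/measurable_EFinP; exact: measurable_expo.
have := @ge0_integral_affine R (fun y => (expo y)%:E) 1 e (oner_neq0 _) m0
  (fun y => expo_ge0 y).
rewrite normr1 invr1 mul1e => I1.
have N1 : (-1 : R) != 0 by rewrite oppr_eq0 oner_neq0.
have := @ge0_integral_affine R (fun y => (expo y)%:E) (-1) 2 N1 m0
  (fun y => expo_ge0 y).
rewrite normrN1 invr1 mul1e => I2.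
under eq_integral do rewrite -[X in X + e]mul1r.
rewrite I1 -I2.
under eq_integral => y _.
  rewrite (_ : expo _ = 2 * exponential_pdf 2^-1 y) ?EFinM; last first.
    by rewrite /expo mulN1r opprD opprK addrCA subrr addr0.
  over.
rewrite ge0_integralZl//.
- by rewrite integral_exponential_pdf ?mule1.
- by apply/measurable_EFinP; exact: measurable_exponential_pdf.
- by move=> y _; rewrite lee_fin exponential_pdf_ge0.
Qed.

End HalfLine.

Section UpperBound.
Context {R : realType} (n : nat).
Local Notation mu := (@lebesgue_measure R).

Lemma val_ord_pred (a : 'I_n) : (0 < a)%N -> val (ord_pred a) = a.-1.
Proof.
case: a => -[//|a] an _ /=.
by rewrite modnDr modn_small// ltnW.
Qed.

Lemma card_low k : (#|[pred a : 'I_n | (a < k)%N]| <= k)%N.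
Proof.
rewrite cardE -(size_map val) -[k in (_ <= k)%N](size_iota 0).
apply: uniq_leq_size; first by rewrite map_inj_uniq ?enum_uniq//; exact: val_inj.
by move=> i /mapP[a]; rewrite mem_enum inE => ak ->; rewrite mem_iota.
Qed.

Lemma card_low1 k : (#|[pred v : torus n | (v.1 < k)%N]| <= k * n)%N.
Proof.
rewrite (@eq_card _ _ [predX [pred a : 'I_n | (a < k)%N] & 'I_n]); last first.
  by move=> v; rewrite !inE andbT.
by rewrite cardX card_ord leq_mul2r card_low orbT.
Qed.

Lemma card_low2 k : (#|[pred v : torus n | (v.2 < k)%N]| <= k * n)%N.
Proof.
rewrite (@eq_card _ _ [predX 'I_n & [pred a : 'I_n | (a < k)%N]]); last first.
  by move=> v; rewrite !inE.
by rewrite cardX card_ord mulnC leq_mul2r card_low orbT.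
Qed.

Variables (s1 s2 S : R).
Hypotheses (S2 : 2 <= S) (s1S : s1 <= S) (s2S : s2 <= S).
Let B := @height R n S.

Lemma height_ge1 : 1 <= B.
Proof.
rewrite /B /height lerDr mulr_ge0//; exact: le_trans S2.
Qed.

Let B0 : 0 <= B. Proof. exact: le_trans height_ge1. Qed.

(** The base of the D_0-rhombus whose last vertex is [v]. *)
Let pp (v : torus n) : torus n := (ord_pred (ord_pred v.1), ord_pred v.2).

Let hess_pp (g : torus n -> R) v : hess0 g (pp v) =
  g v + (g (pp v) - g (ord_pred v.1, ord_pred v.2) - g (ord_pred v.1, v.2)).
Proof. by case: v => a b; rewrite /hess0 /pp/= !ord_predK; ring. Qed.

Let w (v : torus n) (g : torus n -> R) : R :=
  if (v.1 < 2)%N then \1_[set y : R | `|y| <= B] (g v) else expo (hess0 g (pp v)).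

Let c (v : torus n) : R := 2 * (if v \in [pred v : torus n | (v.1 < 2)%N] then B else 1).

Let r (v v' : torus n) := ((v.1 <= v'.1)%N && (v != v')).

Let pp_lt (a : 'I_n) : ~~ (a < 2)%N -> (ord_pred a < a)%N /\ (ord_pred (ord_pred a) < a)%N.
Proof.
rewrite -leqNgt => a2.
have E1 : val (ord_pred a) = a.-1 by apply: val_ord_pred; lia.
have E2 : val (ord_pred (ord_pred a)) = a.-2.
  by rewrite val_ord_pred -?[nat_of_ord (ord_pred a)]/(val (ord_pred a)) E1//; lia.
move: E1 E2 => /= -> ->; lia.
Qed.

Let mball : measurable_fun setT
  (\1_[set y : R | `|y| <= B] : measurableTypeR R -> measurableTypeR R).
Proof. by apply: measurable_indic; exact: measurable_ball. Qed.

(** The other three vertices of the rhombus of [v] have a smaller first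
    coordinate, provided that the rhombus does not wrap around. *)
Let w_rest (v v' : torus n) (g : torus n -> R) (y : R) : ~~ (v.1 < 2)%N -> (v.1 <= v'.1)%N ->
  let h := upd g v' y in
  h (pp v) - h (ord_pred v.1, ord_pred v.2) - h (ord_pred v.1, v.2) =
  g (pp v) - g (ord_pred v.1, ord_pred v.2) - g (ord_pred v.1, v.2).
Proof.
move=> /pp_lt[l1 l2] vv'.
have ne (a b : 'I_n) : (a < v.1)%N -> ((a, b) == v') = false.
  move=> av; apply/negbTE/eqP => v'E; by move: vv'; rewrite -v'E leqNgt av.
by rewrite /= /upd !ne.
Qed.

Let mw v : measurable_fun setT (w v : fspace R (torus n) -> measurableTypeR R).
Proof.
case: (boolP (v.1 < 2)%N) => v2.
  rewrite (_ : w v = fun g => \1_[set y : R | `|y| <= B] (g v)); last first.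
    by apply/funext => g; rewrite /w v2.
  exact: (measurableT_comp mball (@measurable_eval R _ v)).
rewrite (_ : w v = fun g => expo (hess0 g (pp v))); last first.
  by apply/funext => g; rewrite /w (negbTE v2).
exact: (measurableT_comp (@measurable_expo R) (@measurable_hess0 R n (pp v))).
Qed.

Let w0 v h : 0 <= w v h.
Proof. by rewrite /w; case: ifPn => _ //; exact: expo_ge0. Qed.

Let margs_w g :
  (margs (enum (torus n)) (fun h => (\prod_(v <- enum (torus n)) w v h)%:E) g <=
   (2 ^+ (n ^ 2) * B ^+ (2 * n))%:E)%E.
Proof.
(* The last coordinate of the list is integrated first. *)
pose le1 (v v' : torus n) := (v.1 <= v'.1)%N.
pose s := sort le1 (enum (torus n)).
have sE : perm_eq (enum (torus n)) s by rewrite perm_sym perm_sort.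
rewrite (perm_margs _ sE); last first.
  split; last by move=> h; rewrite lee_fin prodr_ge0.
  by apply/measurable_EFinP; apply: measurable_prod => v _; exact: mw.
rewrite (_ : (fun h => _) = (fun h => (\prod_(v <- s) w v h)%:E)); last first.
  by apply/funext => h; congr EFin; exact: perm_big.
apply: (@le_trans _ _ (\prod_(v <- s) c v)%:E).
  apply: (@margs_prod_le _ _ r) => //.
  - by move=> v; rewrite /c mulr_ge0//; case: ifP.
  - move=> v v' /andP[vv' ne] h y; rewrite /w; case: ifPn => v2.
      by rewrite /upd (negbTE ne).
    by rewrite !hess_pp w_rest// /upd (negbTE ne).
  - move=> v h _; rewrite /w /c inE; case: ifPn => v2.
      under eq_integral do rewrite /upd eqxx.
      by rewrite integral_ball.
    under eq_integral do rewrite hess_pp w_rest// {1}/upd eqxx.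
    by rewrite integral_expo mulr1.
  - rewrite pairwise_relI -uniq_pairwise sort_uniq enum_uniq andbT.
    rewrite -sorted_pairwise; last by move=> x y z; exact: leq_trans.
    by apply: sort_sorted => x y; exact: leq_total.
rewrite lee_fin -(perm_big _ sE)/= big_enum/= big_split/= prodr_const card_torus.
rewrite ler_wpM2l ?exprn_ge0// -big_mkcond/= prodr_const.
by rewrite ler_weXn2l ?height_ge1// card_low1.
Qed.

(** The weights dominate the indicator up to the factor e^N: on the thickened
    polytope each weight is at least exp ((D_0 - 2) / 2), and the product of
    these over the whole torus is e^(-N) because the D_0 sum to 0. *)
Lemma margs_thick_le g :
  (margs (enum (torus n)) (EFin \o \1_(thick (sub_hessian 2 s1 s2) 1)) g <=
   ((2 * expR 1) ^+ (n ^ 2) * B ^+ (2 * n))%:E)%E.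
Proof.
have pw : pmeas (fun h : fspace R (torus n) => (\prod_(v <- enum (torus n)) w v h)%:E).
  split; last by move=> h; rewrite lee_fin prodr_ge0.
  by apply/measurable_EFinP; apply: measurable_prod => v _; exact: mw.
have E0 : 0 <= expR 1 ^+ (n ^ 2) :> R by rewrite exprn_ge0// expR_ge0.
rewrite exprMn_comm; last exact: mulrC.
rewrite mulrAC mulrC EFinM.
apply: le_trans (lee_wpmul2l _ (margs_w g)); last by rewrite lee_fin.
rewrite -(@margs_indepM _ _ _ (fun=> (expR 1 ^+ (n ^ 2))%:E))//.
apply: le_margs.
- by apply: pmeas_indic; apply: measurable_thick; exact: measurable_sub_hessian.
- split; last by move=> h; rewrite mule_ge0// ?pw.2// lee_fin.
  by apply: emeasurable_funM; [exact: measurable_cst|exact: pw.1].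
move=> h _ /=; rewrite indicE; case: (boolP (h \in _)); last first.
  by move=> _; rewrite mule_ge0// ?pw.2// lee_fin.
rewrite inE => -[hU hm]; rewrite -EFinM lee_fin.
have hB v : `|h v| <= B.
  apply: (sub_hessian_bound _ S2 s1S s2S hU); first exact: le_trans S2.
  by rewrite -card_torus.
have h2 v : hess0 h v <= 2 by have [] := hU v.
rewrite -ler_pdivrMl ?exprn_gt0 ?expR_gt0// mulr1 -expRM_natl -expRN mulr1.
rewrite big_enum/=.
apply: (@le_trans _ _ (\prod_v expR ((hess0 h (pp v) - 2) / 2))); last first.
  apply: ler_prod => v _; apply/andP; split; first exact: expR_ge0.
  rewrite /w; case: ifPn => v2; last by rewrite expoE.
  rewrite indicE mem_set; last exact: hB.
  rewrite -[X in _ <= X]expR0 ler_expR.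
  by rewrite mulr_le0_ge0// subr_le0.
rewrite -expR_sum ler_expR -mulr_suml sumrB sumr_const card_torus.
have -> : \sum_v hess0 h (pp v) = 0.
  rewrite -[RHS](sum_hess0 h) [RHS](reindex_inj (h := pp))//.
  have ord_pred_inj := can_inj (@ord_predK n).
  move=> [a b] [a' b'] eq_pp.
  have -> : a = a' := ord_pred_inj _ _ (ord_pred_inj _ _ (congr1 fst eq_pp)).
  by have -> : b = b' := ord_pred_inj _ _ (congr1 snd eq_pp).
by rewrite -(mulr_natr 2) sub0r mulNr mulrAC divff// mul1r.
Qed.

End UpperBound.

(** * Independent blocks and fibres *)

Section Blocks.
Context {R : realType} (T I : eqType).

Lemma margs_flatten_ge (blk : I -> seq T) (w : I -> (T -> R) -> R) (c : I -> R)
    (r : seq I) (g : T -> R) :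
  (forall i, measurable_fun setT (w i : fspace R T -> measurableTypeR R)) ->
  (forall i h, 0 <= w i h) -> (forall i, 0 <= c i) ->
  (forall i i' x, i \in r -> i' \in r -> i != i' -> x \in blk i' ->
    forall h y, w i (upd h x y) = w i h) ->
  (forall i h, i \in r -> ((c i)%:E <= margs (blk i) (EFin \o w i) h)%E) ->
  uniq r ->
  ((\prod_(i <- r) c i)%:E <=
   margs (flatten (map blk r)) (fun h => (\prod_(i <- r) w i h)%:E) g)%E.
Proof.
move=> mw w0 c0; elim: r g => [|i r IH] g wr wc /=; first by rewrite !big_nil.
case/andP => ir ur.
have mp : pmeas (fun h : fspace R T => (\prod_(i <- r) w i h)%:E).
  split; last by move=> h; rewrite lee_fin prodr_ge0.
  by apply/measurable_EFinP; apply: measurable_prod => i' _; exact: mw.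
have mwi : pmeas (EFin \o w i : fspace R T -> \bar R).
  split; last by move=> h; rewrite lee_fin.
  by apply/measurable_EFinP; exact: mw.
have C0 : 0 <= \prod_(i <- r) c i by rewrite prodr_ge0.
rewrite (_ : (fun h => _) = (fun h => (w i h)%:E * (\prod_(i <- r) w i h)%:E)%E); last first.
  by apply/funext => h; rewrite big_cons EFinM.
rewrite big_cons mulrC EFinM margs_cat.
apply: (@le_trans _ _ (margs (blk i)
    (fun h => (\prod_(i <- r) c i)%:E * (w i h)%:E)%E g)).
  rewrite (@margs_indepM _ _ _ (fun=> (\prod_(i <- r) c i)%:E))//.
  by apply: lee_wpmul2l; [rewrite lee_fin|apply: wc; rewrite mem_head].
apply: le_margs.
- split; last by move=> h; rewrite mule_ge0// lee_fin.
  by apply: emeasurable_funM => //; exact: mwi.1.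
- apply: pmeas_margs; split; last by move=> h; rewrite mule_ge0// ?mp.2// lee_fin.
  by apply: emeasurable_funM; [exact: mwi.1|exact: mp.1].
move=> h _; rewrite (@margs_indepM _ _ _ (EFin \o w i))//.
- rewrite muleC; apply: lee_wpmul2l; first by rewrite lee_fin.
  apply: IH => // [i1 i2 x i1r i2r|i1 h' i1r].
    by apply: wr; rewrite inE ?i1r ?i2r orbT.
  by apply: wc; rewrite inE i1r orbT.
- by move=> h'; rewrite lee_fin.
- move=> x /flatten_mapP[i' i'r xi'] h' y /=; rewrite (wr i i')//.
  + by rewrite mem_head.
  + by rewrite inE i'r orbT.
  + by apply: contraNneq ir => ->.
Qed.

Lemma uniq_flatten_owner (owner : T -> I) (blk : I -> seq T) (r : seq I) :
  uniq r -> (forall i, i \in r -> uniq (blk i)) ->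
  (forall i x, i \in r -> x \in blk i -> owner x = i) -> uniq (flatten (map blk r)).
Proof.
elim: r => [//|i r IH] /= /andP[ir ur] ub ow.
rewrite cat_uniq ub ?mem_head// IH// ?andbT => [|j jr|j x jr]; last 2 first.
- by apply: ub; rewrite inE jr orbT.
- by apply: ow; rewrite inE jr orbT.
apply/hasPn => x /flatten_mapP[j jr xj]; apply/negP => xi.
have := ow _ _ (mem_head i r) xi; rewrite (ow j)// ?inE ?jr ?orbT// => ji.
by rewrite -ji jr in ir.
Qed.

End Blocks.

Section Fibre.
Context {R : realType} (n : nat).

(** Width two is what separates the tiles: a rhombus spans at most three
    consecutive rows and three consecutive columns. *)
Definition frame (v : torus n) := (v.1 < 2)%N || (v.2 < 2)%N.
Definition frame_seq := [seq v <- enum (torus n) | frame v].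
Definition core_seq := [seq v <- enum (torus n) | ~~ frame v].

Lemma perm_frame_core : perm_eq (enum (torus n)) (frame_seq ++ core_seq).
Proof. by rewrite perm_sym perm_filterC. Qed.

Lemma size_frame : (size frame_seq <= 4 * n)%N.
Proof.
have countE (P : pred (torus n)) : count P (enum (torus n)) = #|[pred v | P v]|.
  by rewrite -sum1_count big_enum_cond sum1_card.
rewrite size_filter; apply: (@leq_trans (count (fun v : torus n => (v.1 < 2)%N) (enum (torus n)) +
    count (fun v : torus n => (v.2 < 2)%N) (enum (torus n)))%N).
  by rewrite -count_predUI; exact: leq_addr.
have -> : (4 * n = 2 * n + 2 * n)%N by rewrite -mulnDl.
by rewrite !countE leq_add// ?card_low1 ?card_low2.
Qed.

Variables (s0 s1 s2 S : R).
Hypotheses (S0 : 0 <= S) (s0S : s0 <= S) (s1S : s1 <= S) (s2S : s2 <= S).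
Let B := @height R n S.

Definition bounded_sub_hessian : set (fspace R (torus n)) :=
  sub_hessian s0 s1 s2 `&` [set g | forall v, `|g v| <= B].
Local Notation A := bounded_sub_hessian.

Lemma measurable_bounded_sub_hessian : measurable A.
Proof.
apply: measurableI; first exact: measurable_sub_hessian.
rewrite (_ : [set g | _] = \bigcap_(v in [set: torus n]) [set g | `|g v| <= B]); last first.
  by apply/seteqP; split => g /= h v; [move=> _; exact: h|exact: h].
apply: fin_bigcap_measurable => [|v _]; first exact: (@finite_finset (torus n)).
rewrite -[X in measurable X]setTI.
exact: ((@measurable_eval R _ v) measurableT _ (measurable_ball B)).
Qed.

Let B0 : 0 <= B.
Proof. by rewrite /B /height addr_ge0// !mulr_ge0. Qed.

(** The values on the frame range over a cube of volume (2 B)^f, where f is the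
    size of the frame, so some fibre has at least the average volume.  The
    factor 2 makes the pigeonhole argument strict. *)
Lemma exists_fibre (J : R) g : 0 < J ->
  (J%:E <= margs (enum (torus n)) (EFin \o \1_(thick (sub_hessian s0 s1 s2) 1)) g)%E ->
  exists2 y, A y & ((J / (2 * (2 * B) ^+ size frame_seq))%:E <=
    margs core_seq (EFin \o \1_A) y)%E.
Proof.
move=> J0 Jle; set c := J / _; apply: contrapT => nex.
have B1 : 1 <= B by rewrite /B /height lerDr !mulr_ge0.
have D0 : 0 < (2 * B) ^+ size frame_seq.
  by rewrite exprn_gt0// mulr_gt0// (lt_le_trans _ B1).
have c0 : 0 <= c by rewrite divr_ge0// ?ltW// mulr_gt0.
have pA : pmeas (EFin \o \1_A : fspace R (torus n) -> \bar R).
  by apply: pmeas_indic; exact: measurable_bounded_sub_hessian.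
have AE y : margs core_seq (EFin \o \1_A) y != 0%E -> forall v, frame v -> `|y v| <= B.
  move=> m0 v fv.
  have : (0 < margs core_seq (EFin \o \1_A) y)%E.
    by rewrite lt0e m0 (pmeas_margs _ pA).2.
  case/margs_exists => y' y'E; rewrite /= indicE.
  case: (boolP (y' \in A)); last by rewrite eqxx.
  rewrite inE => -[_ y'B] _; rewrite -y'E ?y'B//.
  by rewrite mem_filter fv.
have cA y : (margs core_seq (EFin \o \1_A) y <=
    c%:E * (\prod_(v <- frame_seq) \1_[set t : R | `|t| <= B] (y v))%:E)%E.
  have [->|m0] := eqVneq (margs core_seq (EFin \o \1_A) y) 0%E.
    by rewrite mule_ge0// lee_fin prodr_ge0.
  rewrite big_seq big1 ?mule1; last first.
    move=> v; rewrite mem_filter => /andP[fv _].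
    by rewrite indicE mem_set//; exact: AE.
  have : (0 < margs core_seq (EFin \o \1_A) y)%E.
    by rewrite lt0e m0 (pmeas_margs _ pA).2.
  case/margs_exists => y' y'E; rewrite /= indicE.
  case: (boolP (y' \in A)); last by rewrite eqxx.
  rewrite inE => Ay' _; rewrite (@margs_off _ _ _ _ _ y') => [|x xs]; last first.
    by rewrite y'E.
  rewrite leNgt; apply/negP => lt; apply: nex; exists y' => //; exact: ltW.
have mb v : measurable_fun setT (fun h : fspace R (torus n) =>
    (\1_[set t : R | `|t| <= B] (h v) : measurableTypeR R)).
  apply: (measurableT_comp (_ : measurable_fun setT
    (\1_[set t : R | `|t| <= B] : measurableTypeR R -> measurableTypeR R))).
    by apply: measurable_indic; exact: measurable_ball.
  exact: measurable_eval.
have pb : pmeas (fun h : fspace R (torus n) =>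
    (\prod_(v <- frame_seq) \1_[set t : R | `|t| <= B] (h v))%:E).
  split; last by move=> h; rewrite lee_fin prodr_ge0.
  by apply/measurable_EFinP; apply: measurable_prod => v _; exact: mb.
suff : (J%:E <= (J / 2)%:E)%E by rewrite lee_fin ler_pdivlMr//; lra.
apply: (le_trans Jle).
apply: (@le_trans _ _ (margs (enum (torus n)) (EFin \o \1_A) g)).
  apply: le_margs => //.
    by apply: pmeas_indic; apply: measurable_thick; exact: measurable_sub_hessian.
  move=> h _; rewrite lee_fin !indicE; case: (boolP (h \in thick _ _)) => //.
  rewrite inE => -[hU hm]; rewrite mem_set//; split => // v.
  by apply: (sub_hessian_bound S0 s0S s1S s2S hU); rewrite -card_torus.
rewrite (perm_margs pA perm_frame_core) margs_cat.
apply: (@le_trans _ _ (margs frame_seq (fun h =>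
    c%:E * (\prod_(v <- frame_seq) \1_[set t : R | `|t| <= B] (h v))%:E)%E g)).
  apply: le_margs => //; first exact: pmeas_margs.
  split; last by move=> h; rewrite mule_ge0// pb.2.
  by apply: emeasurable_funM => //; exact: pb.1.
rewrite (@margs_indepM _ _ _ (fun=> c%:E))//.
apply: (@le_trans _ _ (c%:E * (\prod_(v <- frame_seq) (2 * B))%:E)%E).
  apply: lee_wpmul2l; first by rewrite lee_fin.
  apply: (@margs_prod_le _ _ (fun v v' => v != v') (fun v h => \1_[set t : R | `|t| <= B] (h v))
     (fun=> 2 * B)) => //.
  - by move=> v; rewrite mulr_ge0.
  - by move=> v v' ne h y; rewrite /upd (negbTE ne).
  - move=> v h _; under eq_integral do rewrite /upd eqxx.
    by rewrite integral_ball.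
  - by rewrite -uniq_pairwise filter_uniq// enum_uniq.
rewrite -EFinM lee_fin big_const_seq count_predT iter_mulr_1 /c.
rewrite le_eqVlt; apply/orP; left; apply/eqP; field.
by rewrite gt_eqF// exprn_gt0// mulr_gt0// (lt_le_trans _ B1).
Qed.

End Fibre.

(** * Tiling a large torus *)

Section Cutoff.
Variables (n K : nat).
Implicit Types v : torus n.

(** K times the function that vanishes on the seam and rises to 1 with slope
    1 / K. *)
Definition cutoff (v : torus n) : nat :=
  minn K (minn (minn v.1 (n.-1 - v.1)) (minn v.2 (n.-1 - v.2))).

Lemma cutoff_le v : (cutoff v <= K)%N. Proof. exact: geq_minl. Qed.

Definition translate i j (v : torus n) : torus n := (iter i (@ordS n) v.1, iter j (@ordS n) v.2).

(** The rhombi based at [v] may then cross the seam of the torus. *)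
Definition wraps (v : torus n) := (n <= v.1 + 2)%N || (n <= v.2 + 2)%N.

Lemma cutoff_wraps v i j : (i <= 2)%N -> (j <= 2)%N -> (2 < n)%N -> wraps v ->
  (cutoff (translate i j v) <= 1)%N.
Proof.
move=> i2 j2 n2 wv; rewrite /cutoff /translate /=.
have H (x : 'I_n) k : (k <= 2)%N -> (n <= x + 2)%N ->
    (minn (iter k (@ordS n) x) (n.-1 - iter k (@ordS n) x) <= 1)%N.
  move=> k2 xn; rewrite -[nat_of_ord _]/(val _) val_iter_ordS.
  have := ltn_ord x; have [kx|kx] := ltnP (x + k) n.
    by rewrite modn_small//; lia.
  move=> ?; rewrite -(subnK kx) modnDr modn_small; lia.
apply: leq_trans (geq_minr _ _) _; case/orP: wv => wv.
  exact: leq_trans (geq_minl _ _) (H _ _ i2 wv).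
exact: leq_trans (geq_minr _ _) (H _ _ j2 wv).
Qed.

Lemma translateE v i j : (i <= 2)%N -> (j <= 2)%N -> ~~ wraps v ->
  ((translate i j v).1 = v.1 + i :> nat)%N /\ ((translate i j v).2 = v.2 + j :> nat)%N.
Proof.
case: v => a b i2 j2; rewrite /wraps negb_or -!ltnNge /= => /andP[w1 w2].
by split; rewrite /translate/= -[LHS]/(val _) val_iter_ordS modn_small//; lia.
Qed.

Lemma cutoff_lipschitz v i j : (i <= 2)%N -> (j <= 2)%N -> ~~ wraps v ->
  (cutoff (translate i j v) <= cutoff v + 2)%N /\ (cutoff v <= cutoff (translate i j v) + 2)%N.
Proof.
move=> i2 j2 wv; have [E1 E2] := translateE i2 j2 wv.
have H (x k : nat) : (k <= 2)%N -> (x + 2 < n)%N ->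
    (minn (x + k) (n.-1 - (x + k)) <= minn x (n.-1 - x) + 2)%N /\
    (minn x (n.-1 - x) <= minn (x + k) (n.-1 - (x + k)) + 2)%N by lia.
move: wv; rewrite /wraps negb_or -!ltnNge => /andP[w1 w2].
have [] := H _ _ i2 w1; have [] := H _ _ j2 w2; rewrite /cutoff E1 E2.
set x1 := minn _ _; set x2 := minn _ _; set y1 := minn _ _; set y2 := minn _ _.
by clearbody x1 x2 y1 y2; split; lia.
Qed.

End Cutoff.

(** A step of length at most 2 that leaves a tile ends in the frame of the next
    tile. *)
Lemma divn_step2 m x k : (1 < m)%N -> (k <= 2)%N ->
  ((x + k) %/ m = x %/ m)%N \/ ((x + k) %% m < 2)%N.
Proof.
move=> m2 k2; have -> : (x + k = x %/ m * m + (x %% m + k))%N.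
  by rewrite {1}(divn_eq x m) addnA.
have m0 : (0 < m)%N by apply: ltnW.
rewrite divnMDl// modnMDl.
have xm := ltn_pmod x m0; have [lt|ge] := ltnP (x %% m + k) m.
  by left; rewrite [((x %% m + k) %/ m)%N]divn_small// addn0.
by right; rewrite -(subnK ge) modnDr modn_small; lia.
Qed.

(** The squares of side [m] are indexed by [nat * nat].  Those with both indices
    in [K, K + q) are full: they fit in the torus and stay at distance at least
    [K] from the seam. *)
Section Tiling.
Variables (m n K q : nat).
Hypotheses (m2 : (1 < m)%N) (K0 : (0 < K)%N) (Kqn : ((K + q) * m + K <= n)%N).

Let m0 : (0 < m)%N. Proof. exact: ltnW. Qed.
Let n0 : (0 < n)%N. Proof. by apply: leq_trans Kqn; rewrite addn_gt0 K0 orbT. Qed.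

Definition tile (ij : nat * nat) (u : torus m) : torus n :=
  (insubd (Ordinal n0) (ij.1 * m + u.1)%N, insubd (Ordinal n0) (ij.2 * m + u.2)%N).

Definition tile_coord (v : torus n) : torus m :=
  (Ordinal (ltn_pmod v.1 m0), Ordinal (ltn_pmod v.2 m0)).

Definition tile_index (v : torus n) : nat * nat := (v.1 %/ m, v.2 %/ m)%N.

Definition full_tile (ij : nat * nat) :=
  (K <= ij.1 < K + q)%N && (K <= ij.2 < K + q)%N.

Definition tile_core (v : torus n) := full_tile (tile_index v) && ~~ frame (tile_coord v).

Let val_tile1 i u : (i < K + q)%N -> (u < m)%N ->
  val (insubd (Ordinal n0) (i * m + u)%N) = (i * m + u)%N.
Proof.
move=> iK um; rewrite val_insubd ifT//.
have : (i.+1 * m <= (K + q) * m)%N by rewrite leq_mul2r iK orbT.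
by rewrite mulSn; lia.
Qed.

Lemma tile_index_tile ij u : full_tile ij -> tile_index (tile ij u) = ij.
Proof.
case: ij => i j /andP[/= /andP[_ iK] /andP[_ jK]]; rewrite /tile_index /tile.
rewrite -[nat_of_ord _]/(val _) -[X in (_, X %/ _)%N]/(val _) !val_tile1//=.
by rewrite !divnMDl// !divn_small// !addn0.
Qed.

Lemma tile_coord_tile ij u : full_tile ij -> tile_coord (tile ij u) = u.
Proof.
case: ij u => i j [a b] /andP[/= /andP[_ iK] /andP[_ jK]]; rewrite /tile_coord /tile/=.
by congr pair; apply: val_inj; rewrite /= -[nat_of_ord _]/(val _) val_tile1//= modnMDl modn_small.
Qed.

Lemma tile_tile_coord v : tile (tile_index v) (tile_coord v) = v.
Proof.
by case: v => a b; congr pair; apply: val_inj; rewrite val_insubd /= -divn_eq ltn_ord.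
Qed.

Lemma cutoff_full v : full_tile (tile_index v) -> cutoff K v = K.
Proof.
case: v => a b /andP[/= /andP[aK1 aK2] /andP[bK1 bK2]]; rewrite /cutoff /=.
have H (x : 'I_n) : (K <= x %/ m)%N -> (x %/ m < K + q)%N -> (K <= x)%N /\ (K <= n.-1 - x)%N.
  move=> h1 h2; split; first by rewrite (leq_trans h1)// leq_div.
  by move: h2; rewrite ltn_divLR// => ?; lia.
have [? ?] := H a aK1 aK2; have [? ?] := H b bK1 bK2; lia.
Qed.

Lemma tile_coord_translate v i j : (i <= 2)%N -> (j <= 2)%N -> ~~ wraps v ->
  tile_coord (translate i j v) =
  (iter i (@ordS m) (tile_coord v).1, iter j (@ordS m) (tile_coord v).2).
Proof.
move=> i2 j2 wv; have [E1 E2] := translateE i2 j2 wv.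
congr pair; apply: val_inj; rewrite [RHS]val_iter_ordS.
  by rewrite -[nat_of_ord (tile_coord v).1]/(v.1 %% m)%N modnDml -E1.
by rewrite -[nat_of_ord (tile_coord v).2]/(v.2 %% m)%N modnDml -E2.
Qed.

(** A vertex of a rhombus either stays in the tile of the base of the rhombus or
    lies on a frame, where all tiles carry the same values. *)
Lemma tile_index_translate v i j : (i <= 2)%N -> (j <= 2)%N -> ~~ wraps v ->
  tile_index (translate i j v) = tile_index v \/ frame (tile_coord (translate i j v)).
Proof.
move=> i2 j2 wv; have [E1 E2] := translateE i2 j2 wv.
rewrite /tile_index E1 E2 /frame.
have [e1|l1] := divn_step2 v.1 m2 i2; last by right; apply/orP; left; rewrite /= E1.
have [e2|l2] := divn_step2 v.2 m2 j2; last by right; apply/orP; right; rewrite /= E2.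
by left; rewrite e1 e2.
Qed.

End Tiling.

(** * Gluing independent functions *)

Section Gluing.
Let rhombus_arith (F : realFieldType) (X b1 b2 b3 b4 g1 g2 g3 g4 h k s e : F) :
  X * (b1 + b2 - b3 - b4) <= k * s + e -> (1 - k) * 2 <= (1 - k) * s ->
  2 * h + e <= (1 - k) * 2 -> g1 - X * b1 <= h -> g2 - X * b2 <= h ->
  0 <= g3 - X * b3 -> 0 <= g4 - X * b4 -> g1 + g2 - g3 - g4 <= s.
Proof. lra. Qed.

Context {R : realType}.
Local Notation mu := (@lebesgue_measure R).
Variables (m n K q : nat).
Hypotheses (m2 : (1 < m)%N) (K0 : (0 < K)%N) (Kqn : ((K + q) * m + K <= n)%N).
Variables (s0 s1 s2 S kappa eta : R).
Hypotheses (s0_2 : 2 <= s0) (s1_2 : 2 <= s1) (s2_2 : 2 <= s2).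
Hypotheses (kappa0 : 0 < kappa) (kappa1 : kappa <= 1) (eta0 : 0 < eta) (eta1 : eta <= 1).
Local Notation B := (@height R m S).
Hypothesis B0 : 0 <= B.
Hypothesis slack : 2 * eta + 8 * (B / K%:R) <= (1 - kappa) * 2.
Local Notation A := (@bounded_sub_hessian R m s0 s1 s2 S).
Variable y0 : torus m -> R.
Hypothesis Ay0 : A y0.

Local Notation tl := (tile K0 Kqn).
Local Notation lc := (tile_coord m2).

(** The function on the small torus that [g] carries on the tile [ij], once
    the shrinking by [kappa] is undone and the frame is reset to that of
    [y0]. *)
Let Theta (ij : nat * nat) (g : torus n -> R) : torus m -> R :=
  fun u => if frame u then y0 u else kappa^-1 * g (tl ij u).

(** At the vertices that are not in the core of a full tile, [g] is only a
    perturbation of the shrunk and cut-off tiling by [y0]. *)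
Let target (v : torus n) : R := kappa * ((cutoff K v)%:R / K%:R) * y0 (lc v).

Let cell (g : torus n -> R) (ij : nat * nat) : torus m -> R :=
  if full_tile K q ij then Theta ij g else y0.

Let tiled (g : torus n -> R) (v : torus n) : R := cell g (tile_index m v) (lc v).

Let KR : (0 : R) < K%:R. Proof. by rewrite ltr0n. Qed.

Let kK0 : 0 <= kappa / K%:R. Proof. by rewrite divr_ge0// ltW. Qed.

Section Inclusion.
Variable g : torus n -> R.
Hypothesis near : forall v, ~~ tile_core K q m2 v -> target v <= g v <= target v + eta.
Hypothesis tiles : forall ij, full_tile K q ij -> A (Theta ij g).

Let cellA ij : A (cell g ij).
Proof. by rewrite /cell; case: ifPn => [/tiles|_]. Qed.

Let cell_frame ij u : frame u -> cell g ij u = y0 u.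
Proof. by move=> fu; rewrite /cell; case: ifPn => // _; rewrite /Theta fu. Qed.

Let tiledB v : `|tiled g v| <= B. Proof. by have [_] := cellA (tile_index m v); apply. Qed.

Let base v : R := (cutoff K v)%:R * tiled g v.

(** So [g] is, up to a remainder between 0 and [eta], the shrunk cut-off of a
    tiling by functions that all agree on the frame.  In the core of a full
    tile the cut-off is 1 and the remainder is 0. *)
Let rem_bound v : 0 <= g v - kappa / K%:R * base v <= eta.
Proof.
have [fv|fv] := boolP (tile_core K q m2 v).
  have /andP[ft nf] := fv.
  rewrite /base /tiled /cell ft /Theta (negbTE nf) tile_tile_coord (cutoff_full m2 K0 Kqn ft)//.
  rewrite (_ : _ - _ = 0) ?lexx ?ltW//; field.
  by rewrite !gt_eqF.
have tE : kappa / K%:R * base v = target v.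
  rewrite /base /target (_ : tiled g v = y0 (lc v)); first by ring.
  rewrite /tiled; have [fr|nfr] := boolP (frame (lc v)); first exact: cell_frame.
  rewrite /cell ifN//; move: fv; rewrite /tile_core negb_and => /orP[//|].
  by rewrite nfr.
rewrite tE; have /andP[h1 h2] := near fv.
by rewrite subr_ge0 h1 lerBlDl h2.
Qed.

Let translate_cell v i j : (i <= 2)%N -> (j <= 2)%N -> ~~ wraps (n := n) v ->
  tiled g (translate i j v) = cell g (tile_index m v)
    (iter i (@ordS m) (lc v).1, iter j (@ordS m) (lc v).2).
Proof.
move=> i2 j2 wv; rewrite /tiled -(tile_coord_translate m2)//.
have [->//|fr] := tile_index_translate m2 i2 j2 wv.
by rewrite !cell_frame.
Qed.

Let baseB v : `|base v| <= (cutoff K v)%:R * B.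
Proof. by rewrite normrM ger0_norm// ler_wpM2l. Qed.

Let base_translate v i j : (i <= 2)%N -> (j <= 2)%N -> ~~ wraps (n := n) v ->
  `|base (translate i j v) - (cutoff K v)%:R * tiled g (translate i j v)| <= 2 * B.
Proof.
move=> i2 j2 wv; rewrite /base -mulrBl normrM ler_pM//.
have [c1 c2] := cutoff_lipschitz K i2 j2 wv.
have c1' : (cutoff K (translate i j v))%:R <= (cutoff K v)%:R + 2 :> R.
  by rewrite -natrD ler_nat.
have c2' : (cutoff K v)%:R <= (cutoff K (translate i j v))%:R + 2 :> R.
  by rewrite -natrD ler_nat.
by rewrite ler_norml; apply/andP; split; lra.
Qed.

(** Away from the seam, replacing the cut-off at the four vertices by its value
    at the base costs 2 B per vertex, and the tiling satisfies the bound [s].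
    Across the seam the cut-off is at most 1 at all four vertices.  In both
    cases the error is at most 8 B, which [slack] absorbs together with the two
    remainders of positive sign. *)
Let rhombus_le (s : R) v (p1 p2 p3 p4 : nat * nat) : 2 <= s ->
  let sh (p : nat * nat) := translate p.1 p.2 v in
  (forall p, p \in [:: p1; p2; p3; p4] -> (p.1 <= 2)%N && (p.2 <= 2)%N) ->
  (~~ wraps (n := n) v ->
    tiled g (sh p1) + tiled g (sh p2) - tiled g (sh p3) - tiled g (sh p4) <= s) ->
  g (sh p1) + g (sh p2) - g (sh p3) - g (sh p4) <= s.
Proof.
move=> s_2 sh p2s tile_le.
have n2 : (2 < n)%N.
  apply: leq_trans Kqn; apply: (@leq_trans (1 * 2 + 1)%N) => //.
  by rewrite leq_add// leq_mul// addn_gt0 K0.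
have i1 : p1 \in [:: p1; p2; p3; p4] by rewrite !inE eqxx.
have i2 : p2 \in [:: p1; p2; p3; p4] by rewrite !inE eqxx orbT.
have i3 : p3 \in [:: p1; p2; p3; p4] by rewrite !inE eqxx !orbT.
have i4 : p4 \in [:: p1; p2; p3; p4] by rewrite !inE eqxx !orbT.
suff base_le : kappa / K%:R * (base (sh p1) + base (sh p2) - base (sh p3) - base (sh p4))
    <= kappa * s + 8 * (B / K%:R).
  have /andP[_ r1] := rem_bound (sh p1); have /andP[_ r2] := rem_bound (sh p2).
  have /andP[r3 _] := rem_bound (sh p3); have /andP[r4 _] := rem_bound (sh p4).
  have ks : (1 - kappa) * 2 <= (1 - kappa) * s by rewrite ler_wpM2l// subr_ge0.
  exact: rhombus_arith base_le ks slack r1 r2 r3 r4.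
have kK : kappa / K%:R * (8 * B) <= 8 * (B / K%:R).
  rewrite mulrAC -!mulrA ler_piMl// mulr_ge0// divr_ge0// ltW//.
have [wv|wv] := boolP (wraps v).
  have bB p : p \in [:: p1; p2; p3; p4] -> `|base (sh p)| <= B.
    move=> /p2s/andP[? ?]; rewrite (le_trans (baseB _))// ler_piMl//.
    by rewrite lern1 cutoff_wraps.
  have := bB _ i1; have := bB _ i2; have := bB _ i3; have := bB _ i4.
  rewrite !ler_norml => /andP[? ?] /andP[? ?] /andP[? ?] /andP[? ?].
  apply: (@le_trans _ _ (kappa / K%:R * (8 * B))).
    by rewrite ler_wpM2l ?kK0//; lra.
  by rewrite (le_trans kK)// lerDr mulr_ge0//; [exact: ltW|exact: le_trans s_2].
have bs p : p \in [:: p1; p2; p3; p4] ->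
    `|base (sh p) - (cutoff K v)%:R * tiled g (sh p)| <= 2 * B.
  by move=> /p2s/andP[? ?]; exact: base_translate.
have := bs _ i1; have := bs _ i2; have := bs _ i3; have := bs _ i4.
rewrite !ler_norml => /andP[? ?] /andP[? ?] /andP[? ?] /andP[? ?].
have cs : (cutoff K v)%:R * (tiled g (sh p1) + tiled g (sh p2) - tiled g (sh p3)
    - tiled g (sh p4)) <= K%:R * s.
  apply: (@le_trans _ _ ((cutoff K v)%:R * s)).
    by rewrite ler_wpM2l// tile_le.
  by rewrite ler_wpM2r ?(le_trans _ s_2)// ler_nat cutoff_le.
apply: (@le_trans _ _ (kappa / K%:R * (K%:R * s + 8 * B))).
  rewrite ler_wpM2l ?kK0//.
  by move: cs; rewrite !mulrBr mulrDr; lra.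
by rewrite mulrDr lerD// mulrA divfK ?gt_eqF.
Qed.

Let sub_hessian_glued : sub_hessian s0 s1 s2 g.
Proof.
move=> [a b].
have [hU _] := cellA (tile_index m (a, b)).
have [h0 h1 h2] := hU (lc (a, b)).
split.
- apply: (@rhombus_le s0 (a, b) (0, 0) (2, 1) (1, 0) (1, 1))%N => //.
    by move=> p; rewrite !inE => /or4P[] /eqP ->.
  by move=> wv; rewrite !translate_cell.
- apply: (@rhombus_le s1 (a, b) (1, 0) (0, 1) (0, 0) (1, 1))%N => //.
    by move=> p; rewrite !inE => /or4P[] /eqP ->.
  by move=> wv; rewrite !translate_cell.
- apply: (@rhombus_le s2 (a, b) (0, 0) (1, 2) (1, 1) (0, 1))%N => //.
    by move=> p; rewrite !inE => /or4P[] /eqP ->.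
  by move=> wv; rewrite !translate_cell.
Qed.

Lemma glued_thick : thick (sub_hessian s0 s1 s2) (B + 1) g.
Proof.
split; first exact: sub_hessian_glued.
rewrite /= mulr_natr -sumr_const (le_trans (ler_norm_sum _ _ _))// ler_sum// => v _.
have /andP[r1 r2] := rem_bound v.
have bB : `|kappa / K%:R * base v| <= B.
  rewrite normrM (ger0_norm kK0).
  apply: (@le_trans _ _ (kappa / K%:R * (K%:R * B))).
    rewrite ler_wpM2l ?kK0// (le_trans (baseB v))// ler_wpM2r//.
    by rewrite ler_nat cutoff_le.
  by rewrite mulrA divfK ?gt_eqF// ler_piMl.
move: bB; rewrite !ler_norml => /andP[b1 b2].
have := eta1; have := B0.
by move=> *; apply/andP; split; lra.
Qed.

End Inclusion.

(** A block is either a single vertex, which is perturbed on its own, or the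
    core of a full tile.  [owner] sends a vertex to its block. *)
Let I : eqType := (torus n + nat * nat)%type.

Let blk (i : I) : seq (torus n) :=
  match i with inl v => [:: v] | inr ij => map (tl ij) (core_seq m) end.

Let owner (x : torus n) : I :=
  if tile_core K q m2 x then inr (tile_index m x) else inl x.

Let tiles_seq := [seq (i, j) | i <- iota K q, j <- iota K q].

Let r : seq I :=
  map inl [seq v <- enum (torus n) | ~~ tile_core K q m2 v] ++ map inr tiles_seq.

Let mem_inl v : ((inl v : I) \in r) = ~~ tile_core K q m2 v.
Proof.
rewrite mem_cat mem_map; last by move=> ? ? [].
rewrite mem_filter mem_enum andbT.
by rewrite orb_idr// => /mapP[].
Qed.

Let mem_inr ij : ((inr ij : I) \in r) = full_tile K q ij.
Proof.
rewrite mem_cat orb_idl => [|/mapP[]//]; rewrite mem_map; last by move=> ? ? [].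
case: ij => i j; rewrite /full_tile -!mem_iota/=.
by apply/allpairsP/andP => [[[? ?] [? ? [-> ->]]]//|[? ?]]; exists (i, j).
Qed.

Let tile_core_tile ij u : full_tile K q ij -> ~~ frame u -> tile_core K q m2 (tl ij u).
Proof.
by move=> fij fu; rewrite /tile_core (tile_index_tile m2)// fij (tile_coord_tile m2).
Qed.

Let owner_blk i x : i \in r -> x \in blk i -> owner x = i.
Proof.
case: i => [v|ij]; rewrite ?mem_inl ?mem_inr => ir /=.
  by rewrite inE => /eqP ->; rewrite /owner (negbTE ir).
move=> /mapP[u]; rewrite mem_filter => /andP[fu _] ->.
by rewrite /owner tile_core_tile// (tile_index_tile m2).
Qed.

Let uniq_r : uniq r.
Proof.
rewrite cat_uniq !map_inj_uniq ?(filter_uniq _ (enum_uniq (torus n)))//=; try by move=> ? ? [].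
apply/andP; split; first by apply/hasPn => _ /mapP[ij _ ->]; apply/negP => /mapP[].
by rewrite allpairs_uniq ?iota_uniq// => -[? ?] [? ?].
Qed.

Let perm_blocks : perm_eq (enum (torus n)) (flatten (map blk r)).
Proof.
apply: uniq_perm; first exact: enum_uniq.
  apply: (uniq_flatten_owner uniq_r _ owner_blk) => -[v|ij]//; rewrite mem_inr => fij /=.
  rewrite map_inj_uniq ?(filter_uniq _ (enum_uniq (torus m)))// => u u' e.
  by rewrite -(tile_coord_tile m2 K0 Kqn u fij) e (tile_coord_tile m2).
move=> x; rewrite mem_enum; apply/esym/flatten_mapP.
have [fx|nfx] := boolP (tile_core K q m2 x).
  have /andP[fij fl] := fx; exists (inr (tile_index m x)); first by rewrite mem_inr.
  apply/mapP; exists (lc x); last by rewrite tile_tile_coord.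
  by rewrite mem_filter fl mem_enum.
by exists (inl x); [rewrite mem_inl|rewrite /= inE].
Qed.

Let size_tiles : size tiles_seq = (q ^ 2)%N.
Proof. by rewrite size_allpairs !size_iota. Qed.

Let size_noncore : size [seq v <- enum (torus n) | ~~ tile_core K q m2 v] =
  (n ^ 2 - q ^ 2 * size (core_seq m))%N.
Proof.
have := perm_size perm_blocks; rewrite -cardE card_torus => ->.
rewrite /r map_cat flatten_cat size_cat -2!map_comp.
have -> : size (flatten [seq (blk \o inl) v |
      v <- [seq v <- enum (torus n) | ~~ tile_core K q m2 v]])
    = size [seq v <- enum (torus n) | ~~ tile_core K q m2 v].
  by rewrite flatten_map1 size_map.
have -> : size (flatten [seq (blk \o inr) ij | ij <- tiles_seq]) = (q ^ 2 * size (core_seq m))%N.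
  rewrite size_flatten /shape -map_comp -size_tiles.
  by elim: tiles_seq => //= ij l ->; rewrite size_map mulSn.
by rewrite addnK.
Qed.

Let window v : set (measurableTypeR R) := [set` `[target v, target v + eta]].

Let w (i : I) (g : torus n -> R) : R :=
  match i with
  | inl v => \1_(window v) (g v)
  | inr ij => \1_A (Theta ij g)
  end.

Let measurable_Theta ij : measurable_fun setT (Theta ij : fspace R (torus n) -> fspace R (torus m)).
Proof.
apply: measurable_fspace => u; rewrite /Theta; case: (frame u) => //.
by apply: measurable_funM => //; exact: measurable_eval.
Qed.

Let measurable_w i : measurable_fun setT (w i : fspace R (torus n) -> measurableTypeR R).
Proof.
case: i => [v|ij] /=.
  apply: (measurableT_comp (_ : measurable_fun setT
    (\1_(window v) : measurableTypeR R -> measurableTypeR R))).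
    by apply: measurable_indic; exact: measurable_itv.
  exact: measurable_eval.
apply: (measurableT_comp (_ : measurable_fun setT
    (\1_A : fspace R (torus m) -> measurableTypeR R))) (measurable_Theta ij).
by apply: measurable_indic; exact: measurable_bounded_sub_hessian.
Qed.

Let w_indep i i' x : i \in r -> i' \in r -> i != i' -> x \in blk i' ->
  forall h y, w i (upd h x y) = w i h.
Proof.
move=> ir i'r ii' xi' h y; have ox := owner_blk i'r xi'.
case: i => [v|ij] in ir ii' *; rewrite /w.
  rewrite /upd ifN//; apply: contraNneq ii' => vx.
  by rewrite -ox -vx (owner_blk ir)//= inE.
congr (\1_A _); apply/funext => u; rewrite /Theta; case: ifPn => // fu.
rewrite /upd ifN//; apply: contraNneq ii' => ux.
by rewrite -ox -ux (owner_blk ir)//=; apply: map_f; rewrite mem_filter fu mem_enum.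
Qed.

(** The constraints of [glued_thick] concern one block each, so the volume that
    they cut out is a product: [eta] for a single vertex, and for a full tile
    the volume of the fibre of [y0] scaled by [kappa] in each coordinate. *)
Lemma margs_glued (v0 : R) g : 0 <= v0 ->
  (v0%:E <= margs (core_seq m) (EFin \o \1_A) y0)%E ->
  ((eta ^+ (n ^ 2 - q ^ 2 * size (core_seq m)) *
    (kappa ^+ size (core_seq m) * v0) ^+ (q ^ 2))%:E <=
   margs (enum (torus n)) (EFin \o \1_(thick (sub_hessian s0 s1 s2) (B + 1))) g)%E.
Proof.
move=> v00 v0le.
pose c (i : I) : R := if i is inl _ then eta else kappa ^+ size (core_seq m) * v0.
have c0 i : 0 <= c i.
  by case: i => [v|ij] /=; [exact: ltW|rewrite mulr_ge0// exprn_ge0// ltW].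
have -> : eta ^+ (n ^ 2 - q ^ 2 * size (core_seq m)) *
    (kappa ^+ size (core_seq m) * v0) ^+ (q ^ 2) = \prod_(i <- r) c i.
  rewrite big_cat !big_map/= !big_const_seq !count_predT !iter_mulr_1.
  by rewrite size_noncore size_tiles.
have pA : pmeas (EFin \o \1_A : fspace R (torus m) -> \bar R).
  by apply: pmeas_indic; exact: measurable_bounded_sub_hessian.
have pw : pmeas (fun h : fspace R (torus n) => (\prod_(i <- r) w i h)%:E).
  split; last by move=> h; rewrite lee_fin prodr_ge0// => -[].
  by apply/measurable_EFinP; apply: measurable_prod => i _; exact: measurable_w.
have pT : pmeas (EFin \o \1_(thick (sub_hessian s0 s1 s2) (B + 1)) :
    fspace R (torus n) -> \bar R).
  by apply: pmeas_indic; apply: measurable_thick; exact: measurable_sub_hessian.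
apply: (@le_trans _ _ (margs (enum (torus n)) (fun h => (\prod_(i <- r) w i h)%:E) g)).
  rewrite (perm_margs pw perm_blocks); apply: margs_flatten_ge => //.
    by case.
  move=> [v|ij] h; rewrite ?mem_inl ?mem_inr => ir /=.
    rewrite /marg /=; under eq_integral do rewrite /upd eqxx.
    rewrite integral_indic//; last exact: measurable_itv.
    rewrite setIT.
    rewrite -[X in (_ <= X)%E]/(lebesgue_measure ([set` `[target v, target v + eta]] : set R)).
    by rewrite lebesgue_measure_itv/= lte_fin ltrDl eta0 -EFinB lee_fin addrC addKr.
  rewrite -[EFin \o w _]/((EFin \o \1_A) \o Theta ij).
  rewrite (@margs_reindex _ _ _ (tl ij) kappa^-1 (core_seq m) (Theta ij))//.
  - rewrite normfV invrK (ger0_norm (ltW kappa0)) EFinM.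
    apply: lee_wpmul2l; first by rewrite lee_fin exprn_ge0// ltW.
    rewrite (@margs_off _ _ _ _ _ y0)// => u; rewrite mem_filter mem_enum andbT negbK.
    by rewrite /Theta => ->.
  - by rewrite invr_eq0 gt_eqF.
  - move=> u; rewrite mem_filter => /andP[fu _] h' y; apply/funext => u'.
    rewrite /Theta /upd; have [->|uu'] := eqVneq u' u; first by rewrite (negbTE fu) eqxx.
    case: ifPn => // fu'; rewrite ifN//; apply: contraNneq uu' => e.
    by rewrite -(tile_coord_tile m2 K0 Kqn u ir) -e (tile_coord_tile m2).
apply: le_margs => // h _ /=; rewrite lee_fin [leRHS]indicE.
case: (boolP (h \in _)) => [_|hT].
  by apply: prodr_ile1 => -[v|ij] _ /=; rewrite indicE; case: (_ \in _); rewrite ?lexx ?ler01.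
suff [i ir wi0] : exists2 i, i \in r & w i h = 0.
  by rewrite (big_rem i)//= wi0 mul0r.
apply: contrapT => nw; move/negP: hT; apply; rewrite inE.
have w1 i : i \in r -> w i h != 0 by move=> ir; apply/eqP => w0; apply: nw; exists i.
apply: glued_thick => [v fv|ij fij].
  have /w1 : (inl v : I) \in r by rewrite mem_inl.
  rewrite /= indicE; case: (boolP (_ \in _)); last by rewrite eqxx.
  by rewrite inE /window/= in_itv.
have /w1 : (inr ij : I) \in r by rewrite mem_inr.
rewrite /= indicE; case: (boolP (_ \in _)); last by rewrite eqxx.
by rewrite inE.
Qed.

End Gluing.

(** * Estimates of the volume *)

Section Volume.
Context {R : realType}.
Variables (s1 s2 : R).
Hypotheses (s12 : 2 <= s1) (s1s2 : s1 <= s2).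
Let s22 : 2 <= s2. Proof. exact: le_trans s12 s1s2. Qed.

Definition volume n : R := fine (mean_zero_volume (hessian_polytope n 2 s1 s2)).
Local Notation B n := (@height R n s2).

Let B1 n : 1 <= B n. Proof. exact: height_ge1. Qed.

Let margs_volumeE n beta : (0 < n)%N -> 0 <= beta ->
  margs (enum (torus n)) (EFin \o \1_(thick (sub_hessian 2 s1 s2) beta)) (fun=> 0) =
  ((2 * beta * n%:R)%:E * mean_zero_volume (hessian_polytope n 2 s1 s2))%E.
Proof.
move=> n0 b0; rewrite margs_thick//.
- by rewrite hessian_polytopeE card_torus natrX sqrtr_sqr ger0_norm.
- by rewrite card_torus expn_gt0 n0.
- exact: measurable_sub_hessian.
- by move=> g c; exact: sub_hessianC.
Qed.

Lemma volumeE n : (0 < n)%N ->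
  mean_zero_volume (hessian_polytope n 2 s1 s2) = (volume n)%:E.
Proof.
move=> n0; have nR : (0 : R) < n%:R by rewrite ltr0n.
have := @margs_thick_le R n s1 s2 s2 s22 s1s2 (lexx s2) (fun=> 0).
rewrite margs_volumeE//; rewrite /volume.
set V := mean_zero_volume _.
have : (0 <= V)%E by exact: measure_ge0.
case: V => [v|//|//] // _.
by rewrite gt0_muley ?lte_fin ?mulr_gt0// leye_eq.
Qed.

Lemma margs_volume n beta : (0 < n)%N -> 0 <= beta ->
  margs (enum (torus n)) (EFin \o \1_(thick (sub_hessian 2 s1 s2) beta)) (fun=> 0) =
  (2 * beta * n%:R * volume n)%:E.
Proof. by move=> n0 b0; rewrite margs_volumeE// volumeE// -EFinM. Qed.

Lemma volume_le n : (0 < n)%N ->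
  2 * n%:R * volume n <= (2 * expR 1) ^+ (n ^ 2) * B n ^+ (2 * n).
Proof.
move=> n0; rewrite -lee_fin.
have := @margs_thick_le R n s1 s2 s2 s22 s1s2 (lexx s2) (fun=> 0).
by rewrite margs_volume// mulr1.
Qed.

Lemma volume_ge n : (0 < n)%N -> 1 <= n%:R * volume n.
Proof.
move=> n0; have := @margs_volume n 2^-1 n0; rewrite invr_ge0 => /(_ (ler0n _ 2)).
rewrite mulfV// mul1r -lee_fin => <-.
pose w (v : torus n) (g : torus n -> R) : R := \1_[set y : R | `|y| <= 2^-1] (g v).
have mw v : measurable_fun setT (w v : fspace R (torus n) -> measurableTypeR R).
  apply: (measurableT_comp (_ : measurable_fun setT
    (\1_[set t : R | `|t| <= 2^-1] : measurableTypeR R -> measurableTypeR R))).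
    by apply: measurable_indic; exact: measurable_ball.
  exact: measurable_eval.
pose f (h : fspace R (torus n)) := (\prod_(v <- enum (torus n)) w v h)%:E.
apply: (@le_trans _ _ (margs (enum (torus n)) f (fun=> 0))).
  have /esym -> : flatten [seq [:: v] | v <- enum (torus n)] = enum (torus n).
    by rewrite flatten_map1 map_id.
  apply: le_trans (margs_flatten_ge (c := fun=> 1) _ mw _ _ _ _ _) => //.
  - by rewrite big1.
  - move=> v v' x _ _ ne; rewrite inE => /eqP -> h y.
    by rewrite /w /upd ifN.
  - move=> v h _; rewrite /= /marg /= /w; under eq_integral do rewrite /upd eqxx.
    by rewrite integral_ball ?invr_ge0// divff.
  - exact: enum_uniq.
apply: le_margs.
- split; last by move=> h; rewrite lee_fin prodr_ge0.
  by apply/measurable_EFinP; apply: measurable_prod => v _; exact: mw.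
- by apply: pmeas_indic; apply: measurable_thick; exact: measurable_sub_hessian.
move=> h _; rewrite /f lee_fin [leRHS]indicE; have [hT|hT] := boolP (h \in _).
  by apply: prodr_ile1 => v _; rewrite /w indicE; case: (_ \in _); rewrite ?lexx ?ler01.
suff [v v_big] : exists v, ~~ (`|h v| <= 2^-1).
  rewrite (big_rem v) ?mem_enum//= {1}/w indicE memNset ?mul0r//.
  exact/negP.
apply: contrapT => nv; move/negP: hT; apply; rewrite inE.
have hv v : `|h v| <= 2^-1 by apply: contrapT => hv; apply: nv; exists v; exact/negP.
split; last first.
  rewrite /= mulr_natr -sumr_const (le_trans (ler_norm_sum _ _ _))// ler_sum// => v _.
have h1 v : - 2^-1 <= h v <= 2^-1 by rewrite -ler_norml.
move=> [a b]; rewrite /hess0 /hess1 /hess2.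
have := s12; have := s22.
split; move: (h1 (a, b)) (h1 (ordS (ordS a), ordS b)) (h1 (ordS a, ordS b)) (h1 (a, ordS b))
  (h1 (ordS a, b)) (h1 (ordS a, ordS (ordS b)));
  do ![move=> /andP[? ?]]; lra.
Qed.

Lemma volume_gt0 n : (0 < n)%N -> 0 < volume n.
Proof.
move=> n0; have nR : (0 : R) < n%:R by rewrite ltr0n.
rewrite -(pmulr_rgt0 _ nR); exact: lt_le_trans ltr01 (volume_ge n0).
Qed.

(** Here [f] is the size of the frame; the shrinking factor is 1 - 1 / m and the
    perturbations have size 1 / (2 m). *)
Lemma volume_glue m n K q : (1 < m)%N -> (0 < K)%N -> ((K + q) * m + K <= n)%N ->
  8 * B m * m%:R <= K%:R ->
  exists f : nat, (f <= 4 * m)%N /\ (f <= m ^ 2)%N /\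
  (2 * m%:R)^-1 ^+ (n ^ 2 - q ^ 2 * (m ^ 2 - f)) *
    ((1 - m%:R^-1) ^+ (m ^ 2 - f) * (m%:R * volume m / (2 * B m) ^+ f)) ^+ (q ^ 2)
  <= 2 * (B m + 1) * n%:R * volume n.
Proof.
move=> m2 K0 Kqn KB; exists (size (frame_seq m)).
have m0 : (0 < m)%N by apply: ltnW.
have mR : (0 : R) < m%:R by rewrite ltr0n.
have KR : (0 : R) < K%:R by rewrite ltr0n.
have B0 : 0 <= B m by apply: le_trans (B1 m).
have n0 : (0 < n)%N by apply: leq_trans Kqn; rewrite addn_gt0 K0 orbT.
have sz := perm_size (perm_frame_core m).
rewrite -cardE card_torus size_cat in sz.
split; first exact: size_frame.
split; first by rewrite sz leq_addr.
have -> : (m ^ 2 - size (frame_seq m) = size (core_seq m))%N by rewrite sz addKn.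
have s20 : 0 <= s2 by apply: le_trans s22.
have Vm := margs_volume m0 ler01; rewrite mulr1 in Vm.
have J0 : 0 < 2 * m%:R * volume m by rewrite !mulr_gt0// volume_gt0.
have [y0 Ay0] : exists2 y, bounded_sub_hessian 2 s1 s2 s2 y &
    ((2 * m%:R * volume m / (2 * (2 * B m) ^+ size (frame_seq m)))%:E <=
     margs (core_seq m) (EFin \o \1_(bounded_sub_hessian 2 s1 s2 s2)) y)%E.
  by apply: (exists_fibre s20 s22 s1s2 (lexx s2) J0 (g := fun=> 0)); rewrite Vm.
set v0 := _ / _ => v0le.
have v0E : v0 = m%:R * volume m / (2 * B m) ^+ size (frame_seq m).
  by rewrite /v0 -mulrA -mulf_div divff// mul1r.
rewrite -v0E -lee_fin.
have B10 : 0 <= B m + 1 by rewrite addr_ge0.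
rewrite -(margs_volume n0 B10).
have mV1 : m%:R^-1 <= 2^-1 :> R by rewrite lef_pV2 ?posrE// ler_nat.
apply: (margs_glued m2 K0 Kqn (lexx _) s12 s22 _ _ _ _ B0 _ Ay0 _ _ v0le).
- by rewrite subr_gt0 invf_lt1// ltr1n.
- by rewrite lerBlDr lerDl invr_ge0.
- by rewrite invr_gt0 mulr_gt0.
- by rewrite invf_le1 ?mulr_gt0// -natrM ler1n muln_gt0.
- have -> : 2 * (2 * m%:R)^-1 = m%:R^-1 :> R by field; rewrite gt_eqF.
  suff : 8 * (B m / K%:R) <= m%:R^-1 by lra.
  by rewrite mulrA ler_pdivrMr// [leRHS]mulrC ler_pdivlMr.
- by rewrite v0E divr_ge0 ?exprn_ge0 ?mulr_ge0// ltW// volume_gt0.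
Qed.

End Volume.

(** * Convergence *)

Section Limits.
Context {R : realType}.

Lemma lnXn_natr n (x : R) : 0 < x -> ln (x ^+ n) = n%:R * ln x.
Proof. by move=> x0; rewrite lnXn// mulr_natl. Qed.

Lemma cvg_inv_nat : (n%:R^-1 : R) @[n --> \oo] --> (0 : R).
Proof.
have pos : \forall n \near \oo, (0 : R) < n%:R.
  by exists 1%N => // n /= n1; rewrite ltr0n.
exact: (gtr0_cvgV0 pos).2 cvgr_idn.
Qed.

Lemma ln_le_sqrt (x : R) : 0 < x -> ln x <= 2 * Num.sqrt x.
Proof.
move=> x0; have s0 : 0 < Num.sqrt x by rewrite sqrtr_gt0.
rewrite -{1}(sqr_sqrtr (ltW x0)) lnXn// mulr_natl lerMn2r/=.
exact/ltW/ln_sublinear.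
Qed.

Lemma cvg_ln_nat_div : (ln (n%:R : R) / n%:R) @[n --> \oo] --> (0 : R).
Proof.
apply: (@squeeze_cvgr _ _ _ _ (fun=> 0) (fun n => 2 * Num.sqrt n%:R^-1)).
- exists 1%N => // n /= n1; have nR : (0 : R) < n%:R by rewrite ltr0n.
  rewrite divr_ge0 ?ln_ge0 ?ler1n//=.
  rewrite ler_pdivrMr// (le_trans (ln_le_sqrt nR))// -mulrA ler_wpM2l//.
  rewrite sqrtrV// -[X in _ <= _ * X](sqr_sqrtr (ltW nR)) expr2 mulrA.
  by rewrite mulVf ?mul1r// gt_eqF// sqrtr_gt0.
- exact: cvg_cst.
- rewrite -[X in _ --> X](mulr0 2); apply: cvgM; first exact: cvg_cst.
  rewrite -[X in _ --> X]sqrtr0; apply: (cvg_comp _ Num.sqrt cvg_inv_nat).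
  exact: sqrt_continuous.
Qed.

(** The limit is the supremum of the [a m - e m]: the sequence is eventually
    above each of them, and is at most [e n] above their supremum. *)
Lemma cvg_almost_superadditive (a e : nat -> R) (m0 : nat) (M : R) :
  (\forall n \near \oo, a n <= M) -> e n @[n --> \oo] --> (0 : R) ->
  (forall m, (m0 <= m)%N -> forall d, 0 < d ->
     \forall n \near \oo, a m - e m - d <= a n) ->
  exists l : R, a n @[n --> \oo] --> l.
Proof.
move=> aM e0 low.
pose X := [set a m - e m | m in [set m | (m0 <= m)%N]].
have Xub : ubound X (M + 1).
  move=> _ [m m0m <-].
  have /(_ m m0m 1 ltr01) [N1 _ H1] := low.
  have [N2 _ H2] := aM.
  have := H1 (maxn N1 N2) (leq_maxl _ _); have := H2 (maxn N1 N2) (leq_maxr _ _).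
  by move=> /= h2 h1; lra.
have Xsup : has_sup X.
  by split; [exists (a m0 - e m0), m0 => //=|exists (M + 1)].
exists (sup X); apply/cvgrPdist_le => d d0.
have d20 : 0 < d / 2 by rewrite divr_gt0.
have [_ [m m0m <-] mX] := sup_adherent d20 Xsup.
have /cvgrPdist_le /(_ d d0) e0' := e0.
near=> n.
have h1 : a m - e m - d / 2 <= a n by near: n; exact: low.
have h2 : `|0 - e n| <= d by near: n; exact: e0'.
have h3 : a n - e n <= sup X.
  apply: (ub_le_sup Xsup.2); exists n => //=.
  by near: n; exists m0.
move: h2; rewrite !ler_norml => /andP[? ?]; apply/andP; split; lra.
Unshelve. all: by end_near. Qed.

End Limits.

Section VolumeLogs.
Context {R : realType}.
Variables (s1 s2 : R).
Hypotheses (s12 : 2 <= s1) (s1s2 : s1 <= s2).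
Let s22 : 2 <= s2. Proof. exact: le_trans s12 s1s2. Qed.
Local Notation B n := (@height R n s2).
Local Notation v n := (volume s1 s2 n).

Let B1 n : 1 <= B n. Proof. exact: height_ge1. Qed.
Let B0 n : 0 < B n. Proof. exact: lt_le_trans (B1 n). Qed.

Definition log_density n : R := ln (v n) / (n ^ 2)%:R.
Local Notation a := log_density.

Let n2a n : (0 < n)%N -> (n ^ 2)%:R * a n = ln (v n).
Proof. by move=> n0; rewrite mulrC divfK// pnatr_eq0 -lt0n expn_gt0 n0. Qed.

Lemma log_density_ge n : (0 < n)%N -> - (ln n%:R / n%:R) <= a n.
Proof.
move=> n0; have nR : (0 : R) < n%:R by rewrite ltr0n.
have vn := volume_gt0 s12 s1s2 n0.
have := volume_ge s12 s1s2 n0; rewrite -ler_ln ?posrE ?mulr_gt0// ln1 lnM ?posrE//.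
have ln0 : 0 <= ln n%:R :> R by rewrite ln_ge0// ler1n.
move=> h; rewrite -mulNr ler_pdivrMr//.
rewrite /a natrX expr2 invfM mulrA divfK ?gt_eqF// ler_pdivlMr//.
rewrite -lerN2 mulNr opprK; apply: le_trans (_ : ln n%:R <= _); first by lra.
by rewrite ler_peMr// ler1n.
Qed.

Lemma log_density_le n : (0 < n)%N -> a n <= ln 2 + 1 + 2 * (ln (B n) / n%:R).
Proof.
move=> n0; have nR : (0 : R) < n%:R by rewrite ltr0n.
have vn := volume_gt0 s12 s1s2 n0.
have e0 := expR_gt0 (1 : R).
have := volume_le s12 s1s2 n0.
rewrite -ler_ln ?posrE ?mulr_gt0 ?exprn_gt0// ?mulr_gt0//.
rewrite [ln (_ * v n)]lnM ?posrE ?mulr_gt0// [ln (_ ^+ _ * _)]lnM ?posrE ?exprn_gt0 ?mulr_gt0//.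
rewrite !lnXn_natr// ?mulr_gt0// (@lnM _ 2 (expR 1)) ?posrE// expRK.
have l0 : 0 <= ln (2 * n%:R) :> R.
  by rewrite ln_ge0// -natrM ler1n muln_gt0.
move=> h; rewrite /a ler_pdivrMr ?ltr0n ?expn_gt0 ?n0//.
have -> : (ln 2 + 1 + 2 * (ln (B n) / n%:R)) * (n ^ 2)%:R =
    (n ^ 2)%:R * (ln 2 + 1) + (2 * n)%:R * ln (B n).
  by rewrite natrM natrX; field; rewrite gt_eqF.
by lra.
Qed.

(** The first term is the shrinking by 1 - 1 / m.  In the second, each of the at
    most 4 m vertices of the frame of a tile costs ln (2 m) for being confined
    to an interval of length 1 / (2 m), and ln (2 B) for the choice of the
    fibre. *)
Definition glue_error m : R :=
  - ln (1 - m%:R^-1) + 4 * ((ln (2 * m%:R) + ln (2 * B m)) / m%:R).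

Let glue_arith (Q x mm k lm L b am N C D NA : R) : 0 <= Q -> 0 < mm ->
  k <= 0 -> 0 <= lm -> 0 <= L -> 0 <= b -> x <= 4 * mm -> 0 <= x ->
  - ((N - Q * (mm ^+ 2 - x)) * L) +
    Q * ((mm ^+ 2 - x) * k + (lm + mm ^+ 2 * am - x * b)) <= C + D + NA ->
  Q * mm ^+ 2 * (L + am - (- k + 4 * ((L + b) / mm))) - N * L - C - D <= NA.
Proof.
move=> Q0 m0 k0 lm0 L0 b0 x4 x0 h.
have e1 : 0 <= (4 * mm - x) * (L + b).
  by rewrite mulr_ge0 ?subr_ge0 ?addr_ge0.
have e2 : 0 <= x * - k by rewrite mulr_ge0// oppr_ge0.
have e3 : 0 <= Q * ((4 * mm - x) * (L + b) + x * - k + lm).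
  by rewrite mulr_ge0// !addr_ge0.
have -> : Q * mm ^+ 2 * (L + am - (- k + 4 * ((L + b) / mm))) =
    Q * (mm ^+ 2 * (L + am + k) - 4 * mm * (L + b)).
  by field; rewrite gt_eqF.
by lra.
Qed.

Lemma log_density_glue m n K q : (1 < m)%N -> (0 < K)%N ->
  ((K + q) * m + K <= n)%N -> 8 * B m * m%:R <= K%:R ->
  ((q * m) ^ 2)%:R * (ln (2 * m%:R) + a m - glue_error m) - (n ^ 2)%:R * ln (2 * m%:R)
    - ln (2 * (B m + 1)) - ln n%:R <= (n ^ 2)%:R * a n.
Proof.
move=> m2 K0 Kqn KB.
have m0 : (0 < m)%N by exact: ltnW.
have n0 : (0 < n)%N by apply: leq_trans Kqn; rewrite addn_gt0 K0 orbT.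
have mR : (0 : R) < m%:R by rewrite ltr0n.
have nR : (0 : R) < n%:R by rewrite ltr0n.
have [f [f4 [fm]]] := volume_glue s12 s1s2 m2 K0 Kqn KB.
set c := (m ^ 2 - f)%N.
have qcn : (q ^ 2 * c <= n ^ 2)%N.
  apply: (@leq_trans ((q * m) ^ 2)%N).
    by rewrite expnMn leq_mul2l leq_subr orbT.
  by rewrite leq_exp2r//; nia.
have vm := volume_gt0 s12 s1s2 m0; have vn := volume_gt0 s12 s1s2 n0.
have k0 : 0 < 1 - m%:R^-1 :> R by rewrite subr_gt0 invf_lt1// ltr1n.
have p1 : 0 < 2 * m%:R :> R by rewrite mulr_gt0.
have p2 : 0 < m%:R * v m / (2 * B m) ^+ f.
  by rewrite divr_gt0 ?exprn_gt0 ?mulr_gt0.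
have p3 : 0 < B m + 1 by rewrite addr_gt0.
have p4 : 0 < (1 - m%:R^-1) ^+ c * (m%:R * v m / (2 * B m) ^+ f).
  by rewrite mulr_gt0// exprn_gt0.
have p5 : 0 < 2 * B m by rewrite mulr_gt0.
have p6 : 0 < 2 * (B m + 1) by rewrite mulr_gt0.
have p7 : 0 < (2 * m%:R)^-1 :> R by rewrite invr_gt0.
have E0 : ln (m%:R * v m / (2 * B m) ^+ f) =
    ln m%:R + ln (v m) - f%:R * ln (2 * B m).
  by rewrite ln_div ?posrE ?exprn_gt0 ?mulr_gt0// lnM ?posrE// lnXn_natr.
have E1 i : ln ((2 * m%:R)^-1 ^+ i *
      ((1 - m%:R^-1) ^+ c * (m%:R * v m / (2 * B m) ^+ f)) ^+ (q ^ 2)) =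
    - (i%:R * ln (2 * m%:R)) + (q ^ 2)%:R * (c%:R * ln (1 - m%:R^-1) +
      (ln m%:R + ln (v m) - f%:R * ln (2 * B m))).
  rewrite [LHS]lnM ?posrE ?exprn_gt0// !lnXn_natr// lnV ?posrE// mulrN.
  by rewrite [ln (_ ^+ c * _)]lnM ?posrE ?exprn_gt0// lnXn_natr// E0.
have E2 : ln (2 * (B m + 1) * n%:R * v n) = ln (2 * (B m + 1)) + ln n%:R + ln (v n).
  by rewrite !lnM ?posrE// mulr_gt0.
rewrite -ler_ln ?posrE ?mulr_gt0 ?exprn_gt0// E1 E2 -[ln (v m)]n2a// -(n2a n0).
rewrite natrB// natrM /c natrB//.
have lk : ln (1 - m%:R^-1) <= 0 :> R by rewrite ln_le0// lerBlDr lerDl invr_ge0.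
have lm : 0 <= ln m%:R :> R by rewrite ln_ge0// ler1n.
have lL : 0 <= ln (2 * m%:R) :> R.
  by rewrite ln_ge0// -natrM ler1n muln_gt0.
have lB : 0 <= ln (2 * B m) :> R.
  rewrite ln_ge0// (le_trans (B1 m))// ler_peMl//; first exact: ltW.
  by rewrite ler1n.
have fr4 : f%:R <= 4 * m%:R :> R by rewrite -natrM ler_nat.
have fr0 : (0 : R) <= f%:R by [].
rewrite /glue_error expnMn natrM [(m ^ 2)%:R]natrX.
exact: glue_arith.
Qed.

End VolumeLogs.

Section Convergence.
Context {R : realType}.
Variables (s1 s2 : R).
Hypotheses (s12 : 2 <= s1) (s1s2 : s1 <= s2).
Let s22 : 2 <= s2. Proof. exact: le_trans s12 s1s2. Qed.
Local Notation B n := (@height R n s2).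
Local Notation a := (log_density s1 s2).

Let B1 n : 1 <= B n. Proof. exact: height_ge1. Qed.

Lemma cvg_ln_height : (ln (B n) / n%:R) @[n --> \oo] --> (0 : R).
Proof.
pose c := ln (8 * s2 + 1).
apply: (@squeeze_cvgr _ _ _ _ (fun=> 0) (fun n => c * n%:R^-1 + 4 * (ln n%:R / n%:R))).
- exists 1%N => // n /= n1; have nR : (0 : R) < n%:R by rewrite ltr0n.
  rewrite divr_ge0 ?ln_ge0//= mulrA -mulrDl ler_wpM2r ?invr_ge0//.
  have s0 : 0 <= s2 by apply: le_trans s22.
  have c0 : 0 < 8 * s2 + 1 by rewrite ltr_wpDl// mulr_ge0.
  rewrite /c -[4 * _]/(4%:R * _) -(lnXn_natr 4 nR) -lnM ?posrE ?exprn_gt0//.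
  rewrite ler_ln ?posrE ?mulr_gt0 ?exprn_gt0//; last exact: lt_le_trans (B1 n).
  rewrite /height [leRHS]mulrDl mul1r lerD//; first by rewrite mulrAC.
  by rewrite exprn_ege1// ler1n.
- exact: cvg_cst.
- rewrite [X in _ --> X](_ : 0 = c * 0 + 4 * 0); last by rewrite !mulr0 addr0.
  by apply: cvgD; apply: cvgM; do ?[exact: cvg_cst|exact: cvg_inv_nat|exact: cvg_ln_nat_div].
Qed.

Lemma cvg_glue_error : glue_error s2 n @[n --> \oo] --> (0 : R).
Proof.
have l1 : - ln (1 - n%:R^-1 : R) @[n --> \oo] --> (0 : R).
  rewrite -oppr0; apply: cvgN; rewrite -ln1.
  have h : (1 - n%:R^-1 : R) @[n --> \oo] --> (1 : R).
    rewrite -[X in _ --> X]subr0; apply: cvgB; [exact: cvg_cst|exact: cvg_inv_nat].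
  exact: (cvg_comp _ _ h (continuous_ln ltr01)).
have l2 : 4 * (2 * (ln 2 * n%:R^-1) + ln n%:R / n%:R + ln (B n) / n%:R)
    @[n --> \oo] --> (0 : R).
  rewrite -[X in _ --> X](mulr0 4); apply: cvgM; first exact: cvg_cst.
  rewrite -[X in _ --> X](addr0 0); apply: cvgD; last exact: cvg_ln_height.
  rewrite -[X in _ --> X](addr0 0); apply: cvgD; last exact: cvg_ln_nat_div.
  rewrite -[X in _ --> X](mulr0 2); apply: cvgM; first exact: cvg_cst.
  rewrite -[X in _ --> X](mulr0 (ln 2)); apply: cvgM; first exact: cvg_cst.
  exact: cvg_inv_nat.
rewrite -[X in _ --> X](addr0 0); apply: cvg_trans (cvgD l1 l2); apply: near_eq_cvg.
exists 1%N => // n /= n1; have nR : (0 : R) < n%:R by rewrite ltr0n.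
rewrite /glue_error !lnM ?posrE//; last exact: lt_le_trans (B1 n).
by congr (_ + 4 * _); ring.
Qed.

(** As n grows with m and K fixed, the full tiles fill up the torus: the ratio
    q m / n tends to 1. *)
Lemma near_log_density m (d : R) : (1 < m)%N -> 0 < d ->
  \forall n \near \oo, a m - glue_error s2 m - d <= a n.
Proof.
move=> m2 d0; have m0 : (0 < m)%N by exact: ltnW.
have B0 : 0 < B m by exact: lt_le_trans (B1 m).
(* With this K the cut-off costs at most 1 / m in the Hessian bounds. *)
pose K := Num.bound (8 * B m * m%:R).
have KB : 8 * B m * m%:R <= K%:R.
  by apply: ltW; apply: archi_boundP; rewrite !mulr_ge0// ltW.
have K0 : (0 < K)%N.
  by rewrite -(ltr0n R); apply: lt_le_trans KB; rewrite !mulr_gt0// ltr0n.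
(* The full tiles leave a margin of at most c0 rows and columns. *)
pose q n := ((n - K) %/ m - K)%N; pose c0 := (K * m + K + m)%N.
pose ratio n : R := (q n * m)%:R / n%:R.
have ratio1 : ratio n @[n --> \oo] --> (1 : R).
  apply: (@squeeze_cvgr _ _ _ _ (fun n => 1 - c0%:R * n%:R^-1) (fun=> 1)).
  - exists c0 => // n /= n_c0.
    have nR : (0 : R) < n%:R by rewrite ltr0n (leq_trans _ n_c0)// /c0; lia.
    have qm : (n <= q n * m + c0)%N /\ (q n * m <= n)%N.
      have := divn_eq (n - K) m; have := ltn_pmod (n - K) m0.
      by rewrite /q /c0 mulnBl; lia.
    rewrite /ratio -[X in X - _](divff (lt0r_neq0 nR)) -mulrBl ler_pM2r ?invr_gt0//.
    rewrite lerBlDr -natrD ler_nat qm.1/= ler_pdivrMr// mul1r ler_nat qm.2 //.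
  - rewrite -[X in _ --> X]subr0 -(mulr0 c0%:R); apply: cvgB; first exact: cvg_cst.
    by apply: cvgM; [exact: cvg_cst|exact: cvg_inv_nat].
  - exact: cvg_cst.
set L := ln (2 * m%:R : R); set X := L + a m - glue_error s2 m.
set C := ln (2 * (B m + 1)).
pose b n := ratio n * ratio n * X - L - (C * n%:R^-1 + ln n%:R / n%:R) * n%:R^-1.
have bX : b n @[n --> \oo] --> a m - glue_error s2 m.
  have -> : a m - glue_error s2 m = 1 * 1 * X - L - (C * 0 + 0) * 0.
    by rewrite /X; ring.
  apply: cvgB; last first.
    apply: cvgM; last exact: cvg_inv_nat.
    apply: cvgD; last exact: cvg_ln_nat_div.
    by apply: cvgM; [exact: cvg_cst|exact: cvg_inv_nat].
  apply: cvgB; last exact: cvg_cst.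
  by apply: cvgM; [exact: cvgM|exact: cvg_cst].
move/cvgrPdist_le : bX => /(_ d d0) bX.
near=> n.
have n_c0 : (c0 <= n)%N by near: n; exists c0.
have nR : (0 : R) < n%:R by rewrite ltr0n (leq_trans _ n_c0)// /c0; lia.
have bn : `|a m - glue_error s2 m - b n| <= d by near: n; exact: bX.
have Kqn : ((K + q n) * m + K <= n)%N.
  have := leq_divM (n - K) m.
  have : (K <= (n - K) %/ m)%N.
    by rewrite leq_divRL//; move: n_c0; rewrite /c0; lia.
  rewrite /q => h; rewrite subnKC//; move: n_c0; rewrite /c0; lia.
have := log_density_glue s12 s1s2 m2 K0 Kqn KB.
rewrite -/L -/C => h.
have : b n <= a n.
  rewrite -(ler_pM2l (_ : 0 < (n ^ 2)%:R)) ?ltr0n ?expn_gt0 -?(ltr0n R) ?nR//.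
  apply: le_trans h; rewrite le_eqVlt; apply/orP; left; apply/eqP.
  rewrite /b /ratio !natrX natrM /X; field; exact: lt0r_neq0.
move: bn; rewrite ler_norml => /andP[_ bn] ba; lra.
Unshelve. all: by end_near. Qed.

Lemma cvg_log_density : exists l : R, [/\ 0 <= l, l <= ln 2 + 1 & a n @[n --> \oo] --> l].
Proof.
have up : ln 2 + 1 + 2 * (ln (B n) / n%:R) @[n --> \oo] --> (ln 2 + 1 : R).
  rewrite -[X in _ --> X]addr0 -(mulr0 2); apply: cvgD; first exact: cvg_cst.
  by apply: cvgM; [exact: cvg_cst|exact: cvg_ln_height].
have low : - (ln n%:R / n%:R) @[n --> \oo] --> (0 : R).
  by rewrite -oppr0; apply: cvgN; exact: cvg_ln_nat_div.
have [|l al] := @cvg_almost_superadditive R a (glue_error s2) 2 (ln 2 + 1 + 1) _ cvg_glue_error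
    (fun m m2 d d0 => near_log_density m2 d0).
  move/cvgrPdist_le : up => /(_ 1 ltr01) up.
  near=> n.
  have n1 : (0 < n)%N by near: n; exists 1%N.
  apply: le_trans (log_density_le s12 s1s2 n1) _.
  have : `|ln 2 + 1 - (ln 2 + 1 + 2 * (ln (B n) / n%:R))| <= 1 by near: n; exact: up.
  by rewrite ler_norml => /andP[? _]; lra.
exists l; split => //.
- apply: ler_cvg_to low al _; exists 1%N => // n /= n1.
  exact: log_density_ge.
- apply: ler_cvg_to al up _; exists 1%N => // n /= n1.
  exact: log_density_le.
Unshelve. all: by end_near. Qed.

End Convergence.

Unset Implicit Arguments.

Theorem lemma3p8 (R : realType) (s0 s1 s2 : R)
    (hs0 : s0 = 2) (hs01 : s0 <= s1) (hs12 : s1 <= s2) :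
  exists l : R, [/\ 1 <= l, l <= 2 * expR 1 &
    (fun n : nat => poweR (mean_zero_volume (hessian_polytope n s0 s1 s2))
                          ((n ^ 2)%N%:R)^-1)
      @ \oo --> l%:E].
Proof.
subst s0; have [l [l0 l1 al]] := cvg_log_density hs01 hs12.
exists (expR l); split.
- by rewrite -expR0 ler_expR.
- by rewrite -[2]lnK ?posrE// -expRD ler_expR.
have el : expR (log_density s1 s2 n) @[n --> \oo] --> expR l.
  by apply: (cvg_comp _ expR al); exact: continuous_expR.
have {}el : (expR (log_density s1 s2 n))%:E @[n --> \oo] --> (expR l)%:E.
  by apply/fine_cvgP; split => //; near=> n.
apply: cvg_trans el; apply: near_eq_cvg; exists 1%N => // n /= n1.
rewrite volumeE// poweR_EFin /powR gt_eqF ?volume_gt0//.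
by rewrite /log_density mulrC.
Unshelve. all: by end_near. Qed.
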